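(* Let $\gamma,\lambda\in\mathbb R$ with $\gamma<1$ and $|\gamma+2\lambda|<1$, let $0<c_1\le c_2<\infty$, and let $K\in C(\mathbb R_*\times\mathbb R_* )$ be a nonnegative symmetric function, homogeneous of degree $\gamma$, satisfying $$c_1 w(x,y)\le K(x,y)\le c_2 w(x,y)\quad\text{for all }x,y\in\mathbb R_*,\qquad w(x,y)=\frac{x^{\gamma+\lambda}}{y^{\lambda}}+\frac{y^{\gamma+\lambda}}{x^{\lambda}}.$$ Let $\phi$ be a self-similar profile with respect to $K$, and let $T>0$. Then $$F(t,d\xi):=t^{-\frac{\gamma+3}{1-\gamma}}\,\phi\bigl(\xi t^{-\frac{2}{1-\gamma}}\bigr)\,d\xi\quad(0<t\le T),\qquad F(0,\cdot)=0,$$ solves the coagulation equation with constant flux coming from the origin with initial condition $F(0,\cdot)=0$, in the sense of the definition in the context.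
   Context: Notation: $\mathbb R_*=(0,\infty)$, $\mathbb R_+=[0,\infty)$; $\mathcal M_+(\mathbb R_+)$ is the space of nonnegative Radon measures on $\mathbb R_+$; $C([0,T],\mathcal M_+(\mathbb R_+))$ is the set of continuous functions from $[0,T]$ to $\mathcal M_+(\mathbb R_+)$; $C^1_c(\mathbb R_+)$ is the set of compactly supported $C^1$ functions on $\mathbb R_+$. $K$ is homogeneous of degree $\gamma$ if $K(bx,by)=b^\gamma K(x,y)$ for all $b,x,y>0$. For a nonnegative measurable $\phi$ on $\mathbb R_*$ the flux is $J_\phi(z):=\int_0^z\int_{z-x}^\infty xK(y,x)\phi(y)\phi(x)\,dy\,dx$, $z>0$. Definition (self-similar profile). A self-similar profile with respect to $K$ is a measurable $\phi\ge0$ on $\mathbb R_*$ with $\int_{\mathbb R_*}x\phi(x)\,dx=1$ and $J_\phi\in L^\infty_{loc}(\mathbb R_* )$, satisfying $J_\phi(z)=1-\int_0^zx\phi(x)\,dx+\frac{2}{1-\gamma}z^2\phi(z)$ for a.e. $z>0$. Definition (coagulation equation with constant flux coming from the origin). $F\in C([0,T],\mathcal M_+(\mathbb R_+))$ is a solution with initial condition $F(0,\cdot)=0$ if $$\sup_{s\in[0,T]}\int_{(0,1]}\xi^qF(s,d\xi)<\infty,\qquad\sup_{s\in[0,T]}\int_{[1,\infty)}\xi^pF(s,d\xi)<\infty,$$ with $q=\min\{1+\gamma+\lambda,1-\lambda,1\}$ and $p=\max\{\gamma+\lambda,-\lambda\}$, and $$\int_{\mathbb R_*}\xi\varphi(t,\xi)F(t,d\xi)=\int_0^t\int_{\mathbb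 R_*}\xi\,\partial_s\varphi(s,\xi)F(s,d\xi)\,ds+\int_0^t\varphi(s,0)\,ds$$ $$+\frac12\int_0^t\int_{\mathbb R_*}\int_{\mathbb R_*}K(\eta,\xi)\bigl[(\xi+\eta)\varphi(s,\xi+\eta)-\xi\varphi(s,\xi)-\eta\varphi(s,\eta)\bigr]F(s,d\xi)F(s,d\eta)\,ds$$ for every $\varphi\in C^1([0,T],C^1_c(\mathbb R_+))$ and every $0\le t<T$.
   Formalization: F∈C([0,T],M_+(R_+)) fails for γ≥-1, where F(t,·) has infinite mass near 0 (e.g. K=2, γ=λ=0); it is replaced by: ξ^q F(t,dξ) is in C([0,T],M_+(R_+)), with q as in the definition; the literal clause is proved for γ<-1. All other clauses are unchanged. *)

(* Defs.v *)
From HB Require Import structures.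
From mathcomp Require Import all_boot all_order all_algebra.
From mathcomp Require Import all_classical all_reals all_analysis.
From mathcomp Require Import measurable_realfun.

Set Implicit Arguments.
Unset Strict Implicit.
Unset Printing Implicit Defensive.

Import Order.TTheory GRing.Theory Num.Theory.
Import numFieldNormedType.Exports.

Local Open Scope classical_set_scope.
Local Open Scope ring_scope.

Definition homogeneous_kernel (R : realType) (gamma : R) (K : R -> R -> R) :=
  forall b x y : R, 0 < b -> 0 < x -> 0 < y ->
    K (b * x) (b * y) = b `^ gamma * K x y.

Definition weight_kernel (R : realType) (gamma lambda x y : R) : R :=
  x `^ (gamma + lambda) / y `^ lambda + y `^ (gamma + lambda) / x `^ lambda.

Definition flux (R : realType) (K : R -> R -> R) (phi : R -> R) (z : R) : \bar R :=
  (\int[lebesgue_measure]_(x in `]0%R, z[)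
     \int[lebesgue_measure]_(y in `](z - x)%R, +oo[)
       (x * K y x * phi y * phi x)%:E)%E.

Record self_similar_profile (R : realType) (gamma : R) (K : R -> R -> R)
    (phi : R -> R) : Prop := SelfSimilarProfile {
  profile_measurable : measurable_fun (`]0, +oo[%classic : set R) phi;
  profile_ge0 : forall x, 0 < x -> 0 <= phi x;
  profile_mass :
    (\int[lebesgue_measure]_(x in `]0%R, +oo[) (x * phi x)%:E)%E = 1%:E;
  (* [flux K phi] belongs to L^oo_loc(]0, +oo[) *)
  profile_flux_bounded : forall a b : R, 0 < a -> a <= b -> exists M : R,
    {ae lebesgue_measure, forall z : R, a <= z <= b -> (flux K phi z <= M%:E)%E};
  profile_flux_eq : {ae lebesgue_measure, forall z : R, 0 < z ->
    (flux K phi z =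
     1%:E - \int[lebesgue_measure]_(x in `]0%R, z[) (x * phi x)%:E
          + (2 / (1 - gamma) * z ^+ 2 * phi z)%:E)%E}
}.

(* derivative of [f] at [x] relative to [A]; one-sided at an endpoint of an
   interval *)
Definition has_derive_in (R : realType) (A : set R) (f : R -> R) (x l : R) :=
  (fun y => (f y - f x) / (y - x)) @ within A x^' --> l.

(* [f] is a C^1 function on [0, +oo[, with derivative [f'], that is supported
   in [0, M] *)
Definition C1c (R : realType) (M : R) (f f' : R -> R) :=
  [/\ forall x, 0 <= x -> has_derive_in `[0, +oo[ f x (f' x),
      {within `[0, +oo[, continuous f'} &
      forall x, 0 <= x -> M < x -> f x = 0].

(* [v s] tends to [w] in C^1 norm on [0, +oo[ along the filter [G] in [s] *)
Definition cvg_C1 (R : realType) (G : set_system R)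
    (v v' : R -> R -> R) (w w' : R -> R) :=
  forall e : R, 0 < e -> \forall s \near G, forall x : R, 0 <= x ->
    `|v s x - w x| + `|v' s x - w' x| <= e.

(* [u] is in C^1([0, T], C^1_c([0, +oo[)), with time derivative [du]. The space
   C^1_c([0, +oo[) has its inductive limit topology, in which a compact set of
   functions, such as the range of [u] or of [du], has a common compact
   support. *)
Definition C1_time_C1c (R : realType) (T : R) (u du : R -> R -> R) :=
  exists (M : R) (ux dux : R -> R -> R), forall t, 0 <= t <= T ->
    [/\ C1c M (u t) (ux t),
        C1c M (du t) (dux t),
        cvg_C1 (within `[0, T] t^')
          (fun s x => (u s x - u t x) / (s - t))
          (fun s x => (ux s x - ux t x) / (s - t)) (du t) (dux t) &
        cvg_C1 (within `[0, T] (nbhs t)) du dux (du t) (dux t)].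

(* [t |-> x^a F(t, dx)] is a continuous map from [0, T] to the nonnegative Radon
   measures on [0, +oo[ with the vague topology. The measures are assumed
   carried by ]0, +oo[; for [a = 0] this is F \in C([0, T], M_+([0, +oo[)). *)
Definition radon_continuous (R : realType) (T a : R)
    (F : R -> {measure set (measurableTypeR R) -> \bar R}) :=
  [/\ forall t, 0 <= t <= T -> F t [set x | x <= 0] = 0%E,
      forall t, 0 <= t <= T -> forall M : R,
        (\int[F t]_(x in `]0%R, M]) (x `^ a)%:E < +oo)%E &
      forall (psi : R -> R) (M : R),
        {within `[0, +oo[, continuous psi} ->
        (forall x, M < x -> psi x = 0) ->
        {within `[0, T],
          continuous (fun t => \int[F t]_(x in `]0, +oo[) (x `^ a * psi x))}].

Definition exponent_origin (R : realType) (gamma lambda : R) : R :=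
  Num.min (Num.min (1 + gamma + lambda) (1 - lambda)) 1.

Definition exponent_infty (R : realType) (gamma lambda : R) : R :=
  Num.max (gamma + lambda) (- lambda).

(* [a = 0] demands F \in C([0, T], M_+([0, +oo[)) itself. Since a self-similar
   profile behaves like x^(-(gamma + 3) / 2) at the origin, the self-similar F
   is locally finite on [0, +oo[ only for [gamma < -1]; the family of measures
   x^q F(t, dx), where q is [exponent_origin gamma lambda], is locally finite
   there as soon as the first moment bound holds. The integrals of the weak
   formulation are absolutely convergent by the two moment bounds. *)
Record constant_flux_solution (R : realType) (gamma lambda : R)
    (K : R -> R -> R) (T a : R)
    (F : R -> {measure set (measurableTypeR R) -> \bar R}) : Prop :=
  ConstantFluxSolution {
  solution_continuous : radon_continuous T a F;
  solution_initial : forall A, measurable A -> F 0 A = 0%E;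
  solution_moment_origin :
    (ereal_sup
       [set \int[F s]_(x in `]0%R, 1%R]) (x `^ exponent_origin gamma lambda)%:E
       | s in `[0%R, T]] < +oo)%E;
  solution_moment_infty :
    (ereal_sup
       [set \int[F s]_(x in `[1%R, +oo[) (x `^ exponent_infty gamma lambda)%:E
       | s in `[0%R, T]] < +oo)%E;
  solution_weak : forall u du : R -> R -> R, C1_time_C1c T u du ->
    forall t, 0 <= t < T ->
    \int[F t]_(x in `]0, +oo[) (x * u t x) =
      \int[lebesgue_measure]_(s in `[0, t])
        (\int[F s]_(x in `]0, +oo[) (x * du s x))
      + \int[lebesgue_measure]_(s in `[0, t]) (u s 0)
      + 2^-1 * \int[lebesgue_measure]_(s in `[0, t])
          (\int[F s]_(y in `]0, +oo[) (\int[F s]_(x in `]0, +oo[)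
             (K y x * ((x + y) * u s (x + y) - x * u s x - y * u s y))))
}.

Section density_measure.
Context d (T : measurableType d) (R : realType)
  (mu : {measure set T -> \bar R}).

Definition density_measure (f : T -> R) (f0 : forall x, 0 <= f x)
    (mf : measurable_fun setT f) : set T -> \bar R :=
  fun A => (\int[mu]_(x in A) (f x)%:E)%E.

Context (f : T -> R) (f0 : forall x, 0 <= f x) (mf : measurable_fun setT f).

Let density_measure0 : density_measure f0 mf set0 = 0%E.
Proof. by rewrite /density_measure integral_set0. Qed.

Let density_measure_ge0 A : (0 <= density_measure f0 mf A)%E.
Proof. by apply: integral_ge0 => x _; rewrite lee_fin. Qed.

Let density_measure_sigma_additive :
  semi_sigma_additive (density_measure f0 mf).
Proof.
have mEf : measurable_fun setT (EFin \o f) by exact: measurableT_comp.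
have Ef0 x : (0 <= (EFin \o f) x)%E by rewrite lee_fin.
by have := semi_sigma_additive_nng_induced (mu := mu) mEf Ef0.
Qed.

HB.instance Definition _ := isMeasure.Build _ _ _ (density_measure f0 mf)
  density_measure0 density_measure_ge0 density_measure_sigma_additive.

End density_measure.

(* the density of F(t, .) for [0 < t]; it is [0] at [t = 0], where F(0, .) = 0 *)
Definition scaled_profile (R : realType) (gamma : R) (phi : R -> R) (t x : R) : R :=
  if (0 < t) && (0 < x) then
    t `^ (- ((gamma + 3) / (1 - gamma))) * phi (x * t `^ (- (2 / (1 - gamma))))
  else 0.

Lemma scaled_profile_ge0 (R : realType) (gamma : R) (K : R -> R -> R)
    (phi : R -> R) (t : R) (H : self_similar_profile gamma K phi) (x : R) :
  0 <= scaled_profile gamma phi t x.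
Proof.
rewrite /scaled_profile; case: ifPn => // /andP[t0 x0].
by rewrite mulr_ge0 ?powR_ge0// (profile_ge0 H)// mulr_gt0// powR_gt0.
Qed.

Lemma measurable_scaled_profile (R : realType) (gamma : R) (K : R -> R -> R)
    (phi : R -> R) (t : R) (H : self_similar_profile gamma K phi) :
  measurable_fun [set: measurableTypeR R] (scaled_profile gamma phi t).
Proof.
rewrite /scaled_profile; case: (ltrP 0 t) => t0 /=; last first.
  exact: measurable_cst.
apply: measurable_fun_if => //.
  exact: measurable_fun_ltr.
rewrite setTI; apply: measurable_funM; first exact: measurable_cst.
set c := t `^ _.
apply: (measurable_comp (F := (`]0, +oo[%classic : set R)) (f := phi)
  (g := fun x : R => x * c)) => //.
- by move=> _ [x /= x0 <-]; rewrite in_itv/= andbT mulr_gt0 ?powR_gt0.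
- exact: (profile_measurable H).
- by apply: measurable_funM.
Qed.

Definition self_similar_flow (R : realType) (gamma : R) (K : R -> R -> R)
    (phi : R -> R) (H : self_similar_profile gamma K phi) (t : R) :
    {measure set (measurableTypeR R) -> \bar R} :=
  density_measure (@lebesgue_measure R)
    (fun x => scaled_profile_ge0 t H x) (measurable_scaled_profile t H).

(* Main.v *)
(* Let rho = 2 / (1 - gamma), so that F(t) is t^(1 - rho) times the image of
   phi dx under y |-> t^rho y.

   A priori bounds. Integrating the profile equation over ]0, r[ bounds the
   integral of the flux J by (1 + rho) r. For x, y in [2r/3, r] and z in
   ]r, 4r/3[ one has x < z < x + y, so the lower bound on K makes the same
   integral at least a multiple of r^(gamma + 2) times the square of the
   integral of phi over [2r/3, r]. That integral is thus at most a multiple of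
   r^(-(gamma + 1) / 2), and summing over a geometric sequence of r shows that
   phi has a finite moment of every order a with (gamma + 1) / 2 < a <= 1. Both
   exponent_origin and, if gamma < -1, 0 are such orders, and the moment of
   order a of F(t) is that of phi times t^(1 + (a - 1) rho), a positive power
   of t.

   Weak formulation. Testing the profile equation with f' gives, by Tonelli,
     int x phi (f + rho x f') =
       f(0) + int int x K(y, x) (f(x + y) - f(x)) phi(y) phi(x),
   absolutely convergent since int |f'| J is finite; symmetrizing in x and y
   produces the collision term. By homogeneity all powers of t cancel when this
   is applied to f(y) = u(s, s^rho y), and the left-hand side is then the part
   of the time derivative of
     int x u(s, x) F(s, dx) = s int u(s, s^rho y) y phi(y) dy
   that does not come from the s-derivative of u. This derivative is continuous
   up to s = 0, where the integral vanishes, so the fundamental theorem of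
   calculus concludes. *)
Require Import Defs.
From mathcomp Require Import all_boot all_order all_algebra.
From mathcomp Require Import all_classical all_reals all_analysis.
From mathcomp Require Import measurable_realfun.
From mathcomp Require Import ring lra.
Import Order.TTheory GRing.Theory Num.Theory.
Import numFieldNormedType.Exports.
Local Open Scope classical_set_scope.
Local Open Scope ring_scope.
Set Implicit Arguments.
Unset Strict Implicit.
Unset Printing Implicit Defensive.

(** * Integration against densities and dilations *)

(** Multiplication by a positive real fixes both infinities, so it distributes even over differences
    with infinite terms. *)
Lemma gt0_muleBr (R : realType) (c : R) (a b : \bar R) : (0 < c)%R ->
  (c%:E * (a - b) = c%:E * a - c%:E * b)%E.
Proof.
move=> c0; have Ec0 : (0 < c%:E)%E by rewrite lte_fin.
case: a b => [a| |] [b| |]/=; rewrite -?EFinB -?EFinM -?EFinB ?mulrBr//;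
  by rewrite ?(gt0_muley Ec0) ?(gt0_muleNy Ec0).
Qed.

(** [fine] sends both infinities to 0, and a real multiple of an infinity is infinite or 0, so
    finiteness of [a] does not matter. *)
Lemma fine_mulfin (R : realType) (c : R) (a : \bar R) :
  fine (c%:E * a)%E = c * fine a.
Proof.
case: a => [r| |]//=; rewrite mulr0;
  (have [c0|c0|->] := ltgtP c 0; last by rewrite mul0e).
- by rewrite lt0_muley ?lte_fin.
- by rewrite gt0_muley ?lte_fin.
- by rewrite lt0_muleNy ?lte_fin.
- by rewrite gt0_muleNy ?lte_fin.
Qed.

Section integral_scale.
Context d (T : measurableType d) (R : realType) (mu : {measure set T -> \bar
  R}).

(* Unlike in [integralZl], the integral of [f] may be infinite or undefined. *)
Lemma measurable_integralZl (D : set T) (f : T -> R) (c : R) : measurable D ->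
  measurable_fun D f -> 0 <= c ->
  (\int[mu]_(x in D) (c * f x)%:E = c%:E * \int[mu]_(x in D) (f x)%:E)%E.
Proof.
move=> mD mf; rewrite le_eqVlt => /predU1P[<-|c0].
  by rewrite mul0e integral0_eq// => x _; rewrite mul0r.
have mEf : measurable_fun D (EFin \o f) by exact/measurable_EFinP.
rewrite integralE [in RHS]integralE [RHS]gt0_muleBr//.
rewrite -!ge0_integralZl ?lee_fin ?(ltW c0)//; last 2 first.
- exact: measurable_funeneg.
- exact: measurable_funepos.
congr (_ - _)%E; apply: eq_integral => x _.
- by rewrite !funeposE/= -!EFin_max -EFinM maxr_pMr ?(ltW c0)// mulr0.
- by rewrite !funenegE/= -!EFin_max -EFinM maxr_pMr ?(ltW c0)// mulr0 mulrN.
Qed.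

Lemma measurable_RintegralZl (D : set T) (f : T -> R) (c : R) : measurable D ->
  measurable_fun D f -> 0 <= c ->
  \int[mu]_(x in D) (c * f x) = c * \int[mu]_(x in D) f x.
Proof.
by move=> mD mf c0; rewrite /Rintegral measurable_integralZl// fine_mulfin.
Qed.

End integral_scale.

Section integral_density_measure.
Context d (T : measurableType d) (R : realType) (mu : {measure set T -> \bar R})
  (g : T -> R) (g0 : forall x, 0 <= g x) (mg : measurable_fun setT g).
Let nu : {measure set T -> \bar R} := density_measure mu g0 mg.
Local Open Scope ereal_scope.
Import HBNNSimple.

(** Splitting a simple function over its level sets reduces the claim to the definition of [nu] on
    each level set. *)
Let integral_density_measure_nnsfun (h : {nnsfun T >-> R}) :
  \int[nu]_x (h x)%:E = \int[mu]_x ((h x)%:E * (g x)%:E).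
Proof.
rewrite integralT_nnsfun sintegralE.
transitivity (\int[mu]_x (\sum_(r \in range h)
    ((r * \1_(h @^-1` [set r]) x)%:E * (g x)%:E))); last first.
  apply: eq_integral => x _; rewrite [in RHS]fimfunE -fsumEFin//.
  by rewrite ge0_mule_fsuml// => r; exact: nnfun_muleindic_ge0.
rewrite ge0_integral_fsum//; last 2 first.
- move=> r; apply: emeasurable_funM; apply/measurable_EFinP => //.
  by apply: measurable_funM => //; exact: measurable_indic.
- move=> r x _; apply: mule_ge0; last by rewrite lee_fin.
  exact: nnfun_muleindic_ge0.
apply: eq_fsbigr => r /[!inE] -[x _ hxr].
have r0 : (0 <= r)%R by rewrite -hxr.
under eq_integral do rewrite EFinM -muleA.
rewrite ge0_integralZl//; last 2 first.
- by apply: emeasurable_funM; apply/measurable_EFinP.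
- by move=> y _; rewrite mule_ge0 ?lee_fin.
congr (_ * _); rewrite /nu/= /density_measure integral_mkcond/=.
apply: eq_integral => y _; rewrite patchE indicE.
by case: ifPn => _; rewrite ?mul1e ?mul0e.
Qed.

(** Extension by 0 reduces to the whole space; there monotone convergence along simple functions is
    applied to both sides. *)
Lemma ge0_integral_density_measure D (f : T -> \bar R) : measurable D ->
  measurable_fun D f -> (forall x, D x -> 0 <= f x) ->
  \int[nu]_(x in D) f x = \int[mu]_(x in D) (f x * (g x)%:E).
Proof.
move=> mD; wlog -> : D mD f / D = setT.
  move=> H mf f0; rewrite integral_mkcond [RHS]integral_mkcond.
  rewrite (H setT)//.
  - apply: eq_integral => x _; rewrite /patch; case: ifPn => //.
    by rewrite mul0e.
  - exact/(measurable_restrictT _ mD).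
  - by move=> x _; rewrite patchE; case: ifPn => // /[!inE] /f0.
move=> mf f0; pose h := nnsfun_approx measurableT mf.
have hf x : EFin \o h^~ x @ \oo --> f x by exact: cvg_nnsfun_approx.
transitivity (limn (fun n => \int[nu]_x (h n x)%:E)).
  rewrite -monotone_convergence//.
  - by apply: eq_integral => x _; apply/esym/cvg_lim => //; exact: hf.
  - by move=> n; exact/measurable_EFinP.
  - by move=> n x _; rewrite lee_fin.
  - by move=> x _ m n mn; rewrite lee_fin; exact/lefP/nd_nnsfun_approx.
under eq_fun do rewrite integral_density_measure_nnsfun.
rewrite -monotone_convergence//.
- apply: eq_integral => x _; apply/cvg_lim => //.
  by apply: cvgeZr => //; exact: hf.
- by move=> n; apply: emeasurable_funM; exact/measurable_EFinP.
- by move=> n x _; rewrite mule_ge0 ?lee_fin.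
- move=> x _ m n mn; rewrite lee_pmul ?lee_fin//.
  exact/lefP/nd_nnsfun_approx.
Qed.

(** Multiplying by the nonnegative [g] commutes with taking positive and negative parts, so infinite
    or undefined integrals are covered too. *)
Lemma integral_density_measure D (f : T -> R) : measurable D ->
  measurable_fun D f ->
  \int[nu]_(x in D) (f x)%:E = \int[mu]_(x in D) (f x * g x)%:E.
Proof.
move=> mD mf; rewrite integralE [RHS]integralE.
have mEf : measurable_fun D (EFin \o f) by exact/measurable_EFinP.
rewrite !ge0_integral_density_measure//; last 2 first.
- exact: measurable_funeneg.
- exact: measurable_funepos.
congr (_ - _); apply: eq_integral => x _.
- by rewrite !funeposE/= -!EFin_max -EFinM maxr_pMl// mul0r.
- by rewrite !funenegE/= -!EFin_max -EFinM maxr_pMl// mul0r mulNr.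
Qed.

End integral_density_measure.

Section integral_dilation.
Context (R : realType).
Local Notation mu := (@lebesgue_measure R).
Local Open Scope ereal_scope.

(** By uniqueness of Lebesgue measure: [c] times the image measure gives every half-open interval
    its length. *)
Lemma pushforward_dilation (c : R) : (0 < c)%R -> forall A, measurable A ->
  pushforward mu (fun x : R => (c * x)%R : measurableTypeR R) A =
  (c^-1)%:E * mu A.
Proof.
move=> c0 A mA.
have mc : measurable_fun setT (fun x : R => (c * x)%R : measurableTypeR R).
  exact: mulrl_measurable.
have ci0 : (0 <= c)%R by exact: ltW.
pose m : {measure set (measurableTypeR R) -> \bar R} :=
  mscale (NngNum ci0)
    (pushforward mu (fun x : R => (c * x)%R : measurableTypeR R)).
suff -> : mu A = m mc A.
  by rewrite /m/= /mscale/= muleA -EFinM mulVf ?gt_eqF// mul1e.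
apply: lebesgue_measure_unique mA => _ [[a b]] _ <-.
rewrite /m/= /mscale/= /pushforward/=.
rewrite [X in _ = _ * mu X](_ : _ = `](c^-1 * a)%R, (c^-1 * b)%R]%classic);
  last first.
  by apply/seteqP; split => x/=; rewrite !in_itv/= ltr_pdivrMl// ler_pdivlMl.
rewrite !lebesgue_measure_itv/= !lte_fin ltr_pM2l ?invr_gt0//.
case: ifPn => _; last by rewrite mule0.
by rewrite -!EFinD -EFinM -mulrBr mulrA mulfV ?gt_eqF// mul1r.
Qed.

Lemma ge0_integral_dilation (c : R) (f : R -> \bar R) : (0 < c)%R ->
  measurable_fun (`]0%R, +oo[%classic : set R) f -> (forall x, (0 < x)%R -> 0
    <= f x) ->
  \int[mu]_(x in `]0%R, +oo[) f x =
  c%:E * \int[mu]_(x in `]0%R, +oo[) f (c * x)%R.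
Proof.
move=> c0 mf f0.
have mc : measurable_fun setT (fun x : R => (c * x)%R : measurableTypeR R).
  exact: mulrl_measurable.
have f0' : forall x, x \in (`]0%R, +oo[%classic : set R) -> 0 <= f x.
  by move=> x /[!inE]/= /[!in_itv]/= /[!andbT]; exact: f0.
have ci0 : (0 <= c^-1)%R by rewrite invr_ge0 ltW.
have := @ge0_integral_pushforward _ _ (measurableTypeR R) (measurableTypeR R) R
  _ mc mu `]0%R, +oo[%classic f _ mf f0'.
move=> /(_ (measurable_itv _)).
rewrite [in RHS](_ : (fun x : R => (c * x)%R : measurableTypeR R) @^-1`
  `]0%R, +oo[ = `]0%R, +oo[%classic); last first.
  by apply/seteqP; split => x/=; rewrite !in_itv/= !andbT pmulr_rgt0.
move=> <-.
rewrite [in RHS](eq_measure_integral (mscale (NngNum ci0) mu)); last first.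
  by move=> A mA _; exact: pushforward_dilation.
rewrite ge0_integral_mscale//=; last first.
  by move=> x; rewrite in_itv/= andbT; exact: f0.
by rewrite muleA -EFinM mulfV ?gt_eqF// mul1e.
Qed.

Lemma integral_dilation (c : R) (f : R -> R) : (0 < c)%R ->
  measurable_fun (`]0%R, +oo[%classic : set R) f ->
  \int[mu]_(x in `]0%R, +oo[) (f x)%:E =
  c%:E * \int[mu]_(x in `]0%R, +oo[) (f (c * x))%:E.
Proof.
move=> c0 mf; have mEf : measurable_fun (`]0%R, +oo[%classic : set R) (EFin \o
  f).
  exact/measurable_EFinP.
have mp := measurable_funepos mEf; have mn := measurable_funeneg mEf.
rewrite integralE (ge0_integral_dilation c0 mp)//.
rewrite [X in _ - X](ge0_integral_dilation c0 mn)//.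
rewrite [in RHS]integralE [RHS]gt0_muleBr//; congr (c%:E * _ - c%:E * _);
  apply: eq_integral => x _.
- by rewrite !funeposE.
- by rewrite !funenegE.
Qed.

End integral_dilation.

(** * Joint measurability of the kernel *)

Section kernel_measurability.
Context (R : realType).
Implicit Types (K : R -> R -> R) (gamma : R).

(* Homogeneity reduces joint measurability of [K] to that of the one-variable
   function [K 1], so that the Borel sets of the plane are not needed. *)
Lemma measurable_homogeneous_kernel gamma K :
  homogeneous_kernel gamma K ->
  {within `]0, +oo[ `*` `]0, +oo[, continuous (fun p : R * R => K p.1 p.2)} ->
  measurable_fun [set: measurableTypeR R * measurableTypeR R]
    (fun z => if (0 < z.1) && (0 < z.2) then K z.1 z.2 else 0).
Proof.
move=> Khom Kcont.
have mk : measurable_fun (`]0, +oo[%classic : set R) (K 1).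
  apply: subspace_continuous_measurable_fun => //.
  rewrite continuous_open_subspace; last exact: interval_open.
  move=> x /[!inE]/= x0.
  have o : open (`]0, +oo[ `*` `]0, +oo[ : set (R * R)).
    rewrite openE => -[a b]/= [a0 b0].
    exists (`]0, +oo[%classic, `]0, +oo[%classic) => //=.
    by split; apply: open_nbhs_nbhs; split => //; exact: interval_open.
  have /(_ (1, x)) : {in `]0, +oo[ `*` `]0, +oo[, continuous (fun p : R * R =>
    K p.1 p.2)}.
    by rewrite continuous_open_subspace in Kcont.
  rewrite inE/= => /(_ _); rewrite !in_itv/= !andbT ltr01.
  rewrite in_itv/= andbT in x0.
  move=> /(_ (conj isT x0)) cK.
  have := @continuous_comp R (R * R)%type R (fun y => (1, y))
    (fun p : R * R => K p.1 p.2) x _ cK; apply.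
  by apply: (@cvg_pair _ _ _ _ (nbhs (1:R)) (nbhs x));
    [exact: cvg_cst|exact: cvg_id].
have mk0 : measurable_fun setT ((K 1) \_ (`]0, +oo[%classic : set R)).
  exact/(measurable_restrictT _ (measurable_itv _)).
(* This is K(x, y) = x^gamma K(1, y / x); the inverse is written as the power -1, which is a
   measurable function. *)
rewrite (_ : (fun _ => _) = (fun z : measurableTypeR R * measurableTypeR R =>
    if 0 < z.1 then z.1 `^ gamma *
      ((K 1) \_ (`]0, +oo[%classic : set R)) (z.2 * z.1 `^ (-1)) else 0));
        last first.
  apply/funext => -[x y]/=; case: ifPn => [/andP[x0 y0]|].
    rewrite x0 patchE mem_set; last first.
      by rewrite /= in_itv/= andbT mulr_gt0// powR_gt0.
    rewrite -Khom// ?mulr_gt0 ?powR_gt0// mulr1.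
    by rewrite powR_inv1 ?ltW// mulrCA mulfV ?gt_eqF// mulr1.
  rewrite negb_and => /orP[/negbTE ->//|y0].
  case: ifPn => // x0; rewrite patchE memNset ?mulr0//=.
  by rewrite in_itv/= andbT pmulr_lgt0 ?powR_gt0//; exact/negP.
apply: measurable_fun_if => //; first exact: measurable_fun_ltr.
apply: measurable_funTS; apply: measurable_funM.
  by apply: (measurableT_comp (measurable_powR gamma)).
apply: (measurableT_comp mk0); apply: measurable_funM => //.
by apply: (measurableT_comp (measurable_powR (-1))).
Qed.

End kernel_measurability.

(** * The flux and its integrals *)

Section crossing_integral.
Context (R : realType).
Local Notation mu := (@lebesgue_measure R).
Local Notation M := (measurableTypeR R).
Variables (k : R -> R -> R).
Hypothesis mk : measurable_fun [set: M * M] (fun z : M * M => k z.1 z.2).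
Hypothesis k0 : forall x y, 0 <= k x y.
Local Open Scope ereal_scope.

(** The flux through [z] with the domain moved into the integrand: a coagulation of [x] with [y]
    counts when it carries [x] across [z]. All integrals then run over the whole line, as Tonelli's
    theorem requires. *)
Definition crossing_integral (z : R) : \bar R :=
  \int[mu]_x \int[mu]_y (if (x < z < x + y)%R then k x y else 0%R)%:E.

Let crossing_ge0 (x y z : R) :
  (0 <= if (x < z < x + y)%R then k x y else 0)%R.
Proof. by case: ifP. Qed.

Let measurable_crossing3 :
  measurable_fun [set: (M * M) * M] (fun w : (M * M) * M =>
    if (w.1.2 < w.1.1 < w.1.2 + w.2)%R then k w.1.2 w.2 else 0%R).
Proof.
have m12 : measurable_fun [set: (M * M) * M] (fun w => w.1.2).
  exact: (measurableT_comp measurable_snd measurable_fst).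
have m11 : measurable_fun [set: (M * M) * M] (fun w => w.1.1).
  exact: (measurableT_comp measurable_fst measurable_fst).
have m2 : measurable_fun [set: (M * M) * M] (fun w => w.2).
  exact: measurable_snd.
apply: measurable_fun_if => //.
  apply: measurable_and; first exact: measurable_fun_ltr.
  by apply: measurable_fun_ltr => //; exact: measurable_funD.
apply: measurable_funTS.
exact: (measurableT_comp mk (measurable_fun_pair m12 m2)).
Qed.

Let A (w : M * M) : \bar R :=
  \int[mu]_y (if (w.2 < w.1 < w.2 + y)%R then k w.2 y else 0%R)%:E.

Let measurable_A : measurable_fun [set: M * M] A.
Proof.
apply: (measurable_fun_fubini_tonelli_F (m2 := mu) (fun w : (M * M) * M =>
    (if (w.1.2 < w.1.1 < w.1.2 + w.2)%R then k w.1.2 w.2 else 0%R)%:E)).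
  exact/measurable_EFinP.
by move=> w; rewrite lee_fin.
Qed.

Let A_ge0 w : 0 <= A w.
Proof. by apply: integral_ge0 => y _; rewrite lee_fin. Qed.

Lemma crossing_integral_ge0 z : 0 <= crossing_integral z.
Proof. by apply: integral_ge0 => x _; exact: (A_ge0 (z, x)). Qed.

Lemma measurable_crossing_integral : measurable_fun [set: M] crossing_integral.
Proof. exact: (measurable_fun_fubini_tonelli_F (m2 := mu) A). Qed.

(** Tonelli's theorem, used twice, makes [z] the innermost variable; for fixed [x] and [y] the
    levels crossed form the interval ]x, x + y[. *)
Lemma integral_crossing_integral (g : M -> R) : measurable_fun setT g ->
  (forall z, 0 <= g z)%R ->
  \int[mu]_z ((g z)%:E * crossing_integral z) =
  \int[mu]_x \int[mu]_y ((k x y)%:E * \int[mu]_(z in `]x, (x + y)%R[) (g z)%:E).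
Proof.
move=> mg g0.
have mEg : measurable_fun [set: M] (EFin \o g) by exact/measurable_EFinP.
transitivity (\int[mu]_z \int[mu]_x ((g z)%:E * A (z, x))).
  apply: eq_integral => z _; rewrite ge0_integralZl ?lee_fin//.
  exact: (measurableT_comp measurable_A).
rewrite (fubini_tonelli (m1 := mu) (m2 := mu) (fun w : M * M => (g w.1)%:E * A
  w)); last 2 first.
- apply: emeasurable_funM => //.
  exact: (measurableT_comp mEg measurable_fst).
- by move=> w; rewrite mule_ge0 ?lee_fin.
apply: eq_integral => x _.
pose B (w : M * M) := ((if (x < w.1 < x + w.2)%R then k x w.2 else 0%R)%:E).
have mB : measurable_fun [set: M * M] B.
  apply/measurable_EFinP.
  apply: (@measurableT_comp _ _ _ _ _ _ (fun w : (M * M) * M =>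
    if (w.1.2 < w.1.1 < w.1.2 + w.2)%R then k w.1.2 w.2 else 0%R)
    _ (fun w : M * M => ((w.1, x), w.2))) => //.
  apply: measurable_fun_pair => //.
  exact: measurable_fun_pair.
have B0 w : 0 <= B w by rewrite lee_fin.
transitivity (\int[mu]_z \int[mu]_y ((g z)%:E * B (z, y))).
  apply: eq_integral => z _; rewrite /A -ge0_integralZl ?lee_fin//.
    exact: (measurableT_comp mB (pair1_measurable z)).
  by move=> y _; rewrite lee_fin.
rewrite (fubini_tonelli (m1 := mu) (m2 := mu) (fun w : M * M => (g w.1)%:E * B
  w)); last 2 first.
- apply: emeasurable_funM => //.
  exact: (measurableT_comp mEg measurable_fst).
- by move=> w; rewrite mule_ge0 ?lee_fin.
apply: eq_integral => y _; rewrite -ge0_integralZl ?lee_fin//; last 2 first.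
- exact: measurable_funTS.
- by move=> z _; rewrite lee_fin.
rewrite [RHS]integral_mkcond; apply: eq_integral => z _.
rewrite patchE (_ : (z \in `]x, (x + y)%R[%classic) = (x < z < x + y)%R).
  rewrite /B/=; case: ifPn => _; last by rewrite mule0.
  exact: muleC.
by apply/idP/idP; rewrite inE/= in_itv.
Qed.

End crossing_integral.

(** Extended by 0 off the open quadrant, since nothing is known about [K] and [phi] there. *)
Definition flux_density (R : realType) (K : R -> R -> R) (phi : R -> R)
    (x y : R) : R :=
  if (0 < x) && (0 < y) then x * K y x * phi y * phi x else 0.

Section profile_flux.
Context (R : realType) (gamma : R) (K : R -> R -> R) (phi : R -> R).
Local Notation mu := (@lebesgue_measure R).
Local Notation M := (measurableTypeR R).
Hypothesis hgamma : gamma < 1.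
Hypothesis Kcont : {within `]0, +oo[ `*` `]0, +oo[,
                continuous (fun p : R * R => K p.1 p.2)}.
Hypothesis Kge0 : forall x y : R, 0 < x -> 0 < y -> 0 <= K x y.
Hypothesis Khom : homogeneous_kernel gamma K.
Hypothesis hphi : self_similar_profile gamma K phi.
Local Notation k := (flux_density K phi).
Local Notation rho := (2 / (1 - gamma)).

Lemma flux_density_ge0 x y : 0 <= k x y.
Proof.
rewrite /flux_density; case: ifPn => // /andP[x0 y0].
by rewrite !mulr_ge0// ?(profile_ge0 hphi)// ?Kge0// ltW.
Qed.

Lemma measurable_profile : measurable_fun (`]0, +oo[%classic : set M) phi.
Proof. exact: profile_measurable hphi. Qed.

Lemma measurable_profile_patch :
  measurable_fun [set: M] (phi \_ (`]0, +oo[%classic : set M)).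
Proof.
by apply/(measurable_restrictT _ (measurable_itv _)); exact: measurable_profile.
Qed.

Lemma measurable_flux_density :
  measurable_fun [set: M * M] (fun z : M * M => k z.1 z.2).
Proof.
have mK := measurable_homogeneous_kernel Khom Kcont.
have mp := measurable_profile_patch.
rewrite (_ : (fun _ => _) = (fun z : M * M =>
    z.1 * (if (0 < z.2) && (0 < z.1) then K z.2 z.1 else 0)
    * (phi \_ `]0, +oo[%classic) z.2 * (phi \_ `]0, +oo[%classic) z.1)).
  apply: measurable_funM; last exact: (measurableT_comp mp measurable_fst).
  apply: measurable_funM; last exact: (measurableT_comp mp measurable_snd).
  apply: measurable_funM => //.
  have ms := measurable_fun_pair (@measurable_snd _ _ M M) measurable_fst.
  exact: (measurableT_comp mK ms).
apply/funext => -[x y]/=; rewrite /flux_density andbC !patchE.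
case: ifPn => [/andP[y0 x0]|_]; last by rewrite mulr0 !mul0r.
by rewrite !mem_set//= in_itv/= andbT.
Qed.

(** In the flux, x < z and y > z - x already force y > 0, so the truncation in [flux_density] loses
    nothing. *)
Lemma flux_crossing z : 0 < z -> flux K phi z = crossing_integral k z.
Proof.
move=> z0; rewrite /flux /crossing_integral integral_mkcond.
apply: eq_integral => x _; rewrite patchE.
case: ifPn => [/[!inE]/= /[!in_itv]/= /andP[x0 xz]|].
  rewrite integral_mkcond; apply: eq_integral => y _; rewrite patchE.
  rewrite xz/= -ltrBlDl /flux_density x0/=.
  case: ifPn => [/[!inE]/= /[!in_itv]/= /[!andbT] zxy|].
    by rewrite zxy (lt_trans _ zxy)// subr_gt0.
  rewrite notin_setE/= in_itv/= andbT => /negP/negbTE zxy.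
  by rewrite zxy.
rewrite notin_setE/= in_itv/= => /negP; rewrite negb_and => xz.
apply/esym/integral0_eq => y _; rewrite /flux_density.
case: ifPn => // /andP[xz' _]; rewrite xz' orbF in xz.
by rewrite (negbTE xz).
Qed.

Lemma crossing_flux_density_le0 z : z <= 0 -> crossing_integral k z = 0%E.
Proof.
move=> z0; apply: integral0_eq => x _; apply: integral0_eq => y _.
rewrite /flux_density; case: ifPn => // /andP[xz' _].
case: ifPn => // /andP[x0 _].
by move: (lt_trans x0 xz'); rewrite ltNge z0.
Qed.

Lemma rho_gt0 : 0 < rho.
Proof. by rewrite divr_gt0// subr_gt0. Qed.

Lemma measurable_moment (a : R) :
  measurable_fun (`]0, +oo[%classic : set M) (fun x => x `^ a * phi x).
Proof.
apply: measurable_funM; last exact: measurable_profile.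
by apply: measurable_funTS; exact: measurable_powR.
Qed.

Lemma measurable_mass :
  measurable_fun (`]0, +oo[%classic : set M) (fun x => x * phi x).
Proof. by apply: measurable_funM; [|exact: measurable_profile]. Qed.

Lemma mass_integrand_ge0 x : (`]0, +oo[%classic : set R) x -> 0 <= x * phi x.
Proof.
by rewrite /= in_itv/= andbT => x0; rewrite mulr_ge0 ?(profile_ge0 hphi)// ltW.
Qed.

Let subitv0oo r : (`]0, r[ : set R) `<=` `]0, +oo[.
Proof. by move=> x/=; rewrite !in_itv/= => /andP[->]. Qed.

Lemma partial_mass_ge0 r : (0 <= \int[mu]_(x in `]0%R, r[) (x * phi x)%:E)%E.
Proof.
by apply: integral_ge0 => x /subitv0oo x0; rewrite lee_fin mass_integrand_ge0.
Qed.

Lemma partial_mass_le1 r : (\int[mu]_(x in `]0%R, r[) (x * phi x)%:E <= 1)%E.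
Proof.
rewrite -(profile_mass hphi); apply: ge0_subset_integral => //.
  by apply/measurable_EFinP; exact: measurable_mass.
by move=> x x0; rewrite lee_fin mass_integrand_ge0.
Qed.

Lemma partial_mass_fin_num r :
  (\int[mu]_(x in `]0%R, r[) (x * phi x)%:E)%E \is a fin_num.
Proof.
rewrite ge0_fin_numE ?partial_mass_ge0//.
by rewrite (le_lt_trans (partial_mass_le1 r))// ltry.
Qed.

(** The profile equation with the nonnegative mass of ]0, z[ discarded. *)
Lemma crossing_le : {ae mu, forall z : R, 0 < z ->
  (crossing_integral k z <= 1%:E + (rho * z ^+ 2 * phi z)%:E)%E}.
Proof.
have aeF := ae_filter_ringOfSetsType mu.
apply: (@filterS _ _ aeF _ _ _ (profile_flux_eq hphi)) => z Hz z0.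
rewrite -flux_crossing// Hz// leeD2r//.
by rewrite leeBlDr ?partial_mass_fin_num// leeDl// partial_mass_ge0.
Qed.

(** On ]0, r[ the term rho z^2 phi(z) is at most rho r times z phi(z), whose integral is at most the
    unit mass. *)
Lemma integral_crossing_le r : 0 < r ->
  (\int[mu]_(z in `]0%R, r[) crossing_integral k z <= ((1 + rho) * r)%:E)%E.
Proof.
move=> r0.
have mc := measurable_crossing_integral measurable_flux_density
  flux_density_ge0.
have rr0 : 0 < rho * r by rewrite mulr_gt0// rho_gt0.
have rr0' := ltW rr0.
apply: (@le_trans _ _ (\int[mu]_(z in `]0%R, r[) (1%:E + (rho * r)%:E * (z *
  phi z)%:E)))%E.
  apply: ae_ge0_le_integral => //.
  - by move=> z _; exact: crossing_integral_ge0 flux_density_ge0 _.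
  - exact: measurable_funTS.
  - move=> z /subitv0oo z0.
    by rewrite adde_ge0// -EFinM lee_fin mulr_ge0// mass_integrand_ge0.
  - apply: emeasurable_funD => //; apply: emeasurable_funM => //.
    by apply/measurable_EFinP; exact: measurable_funS measurable_mass.
  have aeF := ae_filter_ringOfSetsType mu.
  apply: (@filterS _ _ aeF _ _ _ crossing_le) => z Hz;
    rewrite /= in_itv/= => /andP[z0 zr].
  apply: (le_trans (Hz z0)); rewrite leeD2l// -EFinM lee_fin.
  rewrite (_ : _ * z ^+ 2 * phi z = rho * (z * (z * phi z))); last first.
    by rewrite expr2 !mulrA.
  rewrite -[leRHS]mulrA ler_pM2l ?rho_gt0// ler_wpM2r ?(ltW zr)//.
  by apply: mass_integrand_ge0; rewrite /= in_itv/= z0.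
rewrite ge0_integralD//=; last 2 first.
- move=> z /subitv0oo z0.
  by rewrite -EFinM lee_fin mulr_ge0// mass_integrand_ge0.
- apply: emeasurable_funM => //.
  by apply/measurable_EFinP; exact: measurable_funS measurable_mass.
rewrite integral_cst//= lebesgue_measure_itv/= lte_fin r0 oppr0 adde0 mul1e.
have -> : ((1 + rho) * r)%:E = (r%:E + (rho * r)%:E)%E.
  by rewrite -EFinD (mulrDl _ _ r) mul1r.
rewrite leeD2l//.
rewrite ge0_integralZl ?lee_fin//; last 2 first.
- by apply/measurable_EFinP; exact: measurable_funS measurable_mass.
- by move=> z /subitv0oo z0; rewrite lee_fin mass_integrand_ge0.
by rewrite -[leRHS]mule1 lee_pmul2l ?lte_fin// partial_mass_le1.
Qed.

End profile_flux.

(** * Moments of the profile *)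

(* Unlike [ge0_le_integral], no measurability is required. *)
Lemma ge0_integral_mono d (T : measurableType d) (R : realType)
    (mu : {measure set T -> \bar R}) (D : set T) (f g : T -> \bar R) :
  (forall x, D x -> 0 <= f x)%E -> (forall x, D x -> f x <= g x)%E ->
  (\int[mu]_(x in D) f x <= \int[mu]_(x in D) g x)%E.
Proof.
move=> f0 fg; have g0 x : D x -> (0 <= g x)%E.
  by move=> Dx; rewrite (le_trans (f0 x Dx))// fg.
rewrite !ge0_integralE//; apply: le_ereal_sup => _ [h hf <-]; exists h => //.
move=> x; apply: (le_trans (hf x)); rewrite !patchE.
by case: ifPn => // /[!inE]; exact: fg.
Qed.

(** With 2/3 <= x/r <= 1, the power (x/r)^s is at least (2/3)^s for s >= 0 and at least 1 for s < 0;
    the exponent |s| covers both signs. *)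
Lemma powR_annulus_ge (R : realType) (s r x : R) : 0 < r ->
  2 / 3 * r <= x -> x <= r -> (2 / 3) `^ `|s| * r `^ s <= x `^ s.
Proof.
move=> r0 rx xr; have x0 : 0 < x by rewrite (lt_le_trans _ rx)// mulr_gt0.
have xrE : x = (x / r) * r by rewrite divfK// gt_eqF.
have xr0 : 0 < x / r by rewrite divr_gt0.
rewrite {1}xrE [leRHS]powRM ?(ltW xr0) ?(ltW r0)// ler_wpM2r ?powR_ge0//.
have [s0|s0] := leP 0 s.
  rewrite ger0_norm//; apply: ge0_ler_powR => //; rewrite ?nnegrE//.
  - exact: ltW.
  - by rewrite ler_pdivlMr.
rewrite ltr0_norm//; apply: (@le_trans _ _ 1).
  rewrite -[leRHS](powRr0 (2 / 3)); apply: ger_powR; last by lra.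
  by apply/andP; split; lra.
rewrite -[leLHS](powRr0 (x / r)); apply: ger_powR; last by rewrite ltW.
by rewrite xr0/= ler_pdivrMr// mul1r.
Qed.

(** The lower bound for the exponent -s, inverted. *)
Lemma powR_annulus_le (R : realType) (s r x : R) : 0 < r ->
  2 / 3 * r <= x -> x <= r -> x `^ s <= (3 / 2) `^ `|s| * r `^ s.
Proof.
move=> r0 rx xr; have x0 : 0 < x by rewrite (lt_le_trans _ rx)// mulr_gt0.
have := @powR_annulus_ge R (- s) r x r0 rx xr.
rewrite normrN !powRN => H.
have AB : (3 / 2) `^ `|s| * (2 / 3) `^ `|s| = 1 :> R.
  by rewrite -powRM; [|lra|lra]; rewrite (_ : 3 / 2 * (2 / 3) = 1) ?powR1//;
    lra.
rewrite -lef_pV2 ?posrE ?mulr_gt0 ?powR_gt0// invfM.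
by rewrite (_ : ((3 / 2) `^ `|s|)^-1 = (2 / 3) `^ `|s|)//; exact: mulr1_eq.
Qed.

Section profile_moments.
Context (R : realType) (gamma lambda c1 : R) (K : R -> R -> R) (phi : R -> R).
Local Notation mu := (@lebesgue_measure R).
Local Notation M := (measurableTypeR R).
Hypothesis hgamma : gamma < 1.
Hypothesis hc1 : 0 < c1.
Hypothesis Kcont : {within `]0, +oo[ `*` `]0, +oo[,
                continuous (fun p : R * R => K p.1 p.2)}.
Hypothesis Kge0 : forall x y : R, 0 < x -> 0 < y -> 0 <= K x y.
Hypothesis Khom : homogeneous_kernel gamma K.
Hypothesis Klower : forall x y : R, 0 < x -> 0 < y ->
  c1 * weight_kernel gamma lambda x y <= K x y.
Hypothesis hphi : self_similar_profile gamma K phi.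
Local Notation k := (flux_density K phi).
Local Notation rho := (2 / (1 - gamma)).

(** The factor 2/3 comes from x >= 2r/3, and the two powers from bounding y^(gamma + lambda) and
    x^(-lambda) on [2r/3, r]. *)
Let c3 := (2 / 3) * c1 * ((2 / 3) `^ `|gamma + lambda| * (2 / 3) `^ `|-
  lambda|).

Let c3_gt0 : 0 < c3.
Proof. by rewrite /c3 !mulr_gt0 ?powR_gt0. Qed.

Let flux_density_annulus r x y : 0 < r ->
  2 / 3 * r <= x <= r -> 2 / 3 * r <= y <= r ->
  c3 * r `^ (gamma + 1) * (phi y * phi x) <= k x y.
Proof.
move=> r0 /andP[rx xr] /andP[ry yr].
have x0 : 0 < x by rewrite (lt_le_trans _ rx)// mulr_gt0.
have y0 : 0 < y by rewrite (lt_le_trans _ ry)// mulr_gt0.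
rewrite /flux_density x0 y0/= -(mulrA _ (phi y)).
rewrite ler_wpM2r ?mulr_ge0 ?(profile_ge0 hphi)//.
have Kyx : c1 * ((2 / 3) `^ `|gamma + lambda| * (2 / 3) `^ `|- lambda|)
    * r `^ gamma <= K y x.
  apply: le_trans (Klower y0 x0).
  rewrite -mulrA ler_pM2l// /weight_kernel.
  (* One of the two nonnegative terms of the weight suffices for a lower bound. *)
  apply: (@le_trans _ _ (y `^ (gamma + lambda) / x `^ lambda)); last first.
    by rewrite lerDl divr_ge0 ?powR_ge0.
  rewrite -powRN (_ : r `^ gamma = r `^ (gamma + lambda) * r `^ (- lambda)).
    rewrite mulrACA ler_pM ?mulr_ge0 ?powR_ge0//.
    - exact: powR_annulus_ge.
    - exact: powR_annulus_ge.
  rewrite -powRD; first by rewrite addrK.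
  by rewrite (gt_eqF r0) implybT.
rewrite powRD; last by rewrite (gt_eqF r0) implybT.
rewrite powRr1 ?(ltW r0)// (_ : _ * _ = (2 / 3 * r) *
  (c1 * ((2 / 3) `^ `|gamma + lambda| * (2 / 3) `^ `|- lambda|) * r `^ gamma)).
  by rewrite ler_pM// ?mulr_ge0 ?powR_ge0 ?ltW.
by rewrite /c3; ring.
Qed.

(** The ratio 2/3 ensures x + y >= 4r/3 for [x] and [y] in the annulus, so that ]r,
    4r/3[ lies in ]x, x + y[. *)
Let annulus r : set R := `[2 / 3 * r, r]%classic.

Let measurable_annulus_phi r : 0 < r -> measurable_fun (annulus r : set M) phi.
Proof.
move=> r0; apply: measurable_funS (measurable_profile hphi) => //.
move=> x; rewrite /annulus/= !in_itv/= andbT => /andP[rx _].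
by rewrite (lt_le_trans _ rx)// mulr_gt0.
Qed.

Let annulus_gt0 r x : 0 < r -> annulus r x -> 0 < x.
Proof.
by move=> r0; rewrite /annulus/= in_itv/= => /andP[rx _];
  rewrite (lt_le_trans _ rx)// mulr_gt0.
Qed.

(** Every pair in the annulus crosses all levels of ]r, 4r/3[, an interval of length r/3. This
    bounds the flux integral over ]0, 4r/3[ from below. The inequality is between extended reals
    because finiteness of the integral of [phi] is deduced from it only afterwards. *)
Lemma profile_annulus_sqr r : 0 < r ->
  (((c3 / 3 * r `^ (gamma + 1) * r)%:E * (\int[mu]_(x in annulus r) (phi x)%:E)
    *
   (\int[mu]_(x in annulus r) (phi x)%:E)) <= ((1 + rho) * (4 / 3 * r))%:E)%E.
Proof.
move=> r0.
have mkk := measurable_flux_density Kcont Khom hphi.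
have kk0 := flux_density_ge0 Kge0 hphi.
have r43 : 0 < 4 / 3 * r by rewrite mulr_gt0.
apply: le_trans (integral_crossing_le hgamma Kcont Kge0 Khom hphi r43).
(* Testing with the indicator of ]0, 4r/3[ brings the flux integral into the form of
   [integral_crossing_integral]. *)
pose g : M -> R := \1_(`]0, (4 / 3 * r)[%classic : set M).
have mg : measurable_fun setT g by apply: measurable_indic.
have g0 z : 0 <= g z by rewrite /g indicE.
rewrite [leRHS]integral_mkcond.
rewrite [leRHS](eq_integral (fun z => ((g z)%:E * crossing_integral k z)%E));
  last first.
  move=> z _; rewrite patchE /g indicE.
  by case: (z \in _); rewrite ?mul1e ?mul0e.
rewrite integral_crossing_integral//.
pose P := (\int[mu]_(x in annulus r) (phi x)%:E)%E.
have P0 : (0 <= P)%E.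
  by apply: integral_ge0 => x /(annulus_gt0 r0) x0;
    rewrite lee_fin (profile_ge0 hphi).
pose c := c3 / 3 * r `^ (gamma + 1) * r.
have c0 : 0 < c by rewrite /c !mulr_gt0 ?powR_gt0.
have cE : c = c3 * r `^ (gamma + 1) * (r / 3) by rewrite /c; ring.
rewrite -/P -/c; clearbody c.
have mA : measurable (annulus r : set M) by exact: measurable_itv.
have mphi : measurable_fun (annulus r : set M) (EFin \o phi).
  by apply/measurable_EFinP; exact: measurable_annulus_phi.
have phi0 y : annulus r y -> (0 <= (phi y)%:E)%E.
  by move=> /(annulus_gt0 r0) y0; rewrite lee_fin (profile_ge0 hphi).
apply: (@le_trans _ _ (\int[mu]_(x in annulus r) \int[mu]_(y in annulus r)
   ((c * phi x)%:E * (phi y)%:E))%E).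
  rewrite [leRHS](eq_integral (fun x : M => (c%:E * P * (phi x)%:E)%E));
    last first.
    move=> x /[!inE] /phi0; rewrite lee_fin => x0; rewrite ge0_integralZl//.
      by rewrite EFinM -muleA (muleC _ P) muleA.
    by rewrite lee_fin mulr_ge0// ltW.
  by rewrite ge0_integralZl// mule_ge0// lee_fin ltW.
rewrite integral_mkcond; apply: ge0_integral_mono => [x _|x _].
  rewrite patchE; case: ifPn => // /[!inE] /phi0; rewrite lee_fin => x0.
  apply: integral_ge0 => y /phi0 y0; apply: mule_ge0 => //.
  by rewrite lee_fin mulr_ge0// ltW.
rewrite patchE; case: ifPn => [/[!inE] xA|_]; last first.
  apply: integral_ge0 => y _; rewrite mule_ge0 ?lee_fin//.
  by apply: integral_ge0 => z _; rewrite lee_fin.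
rewrite integral_mkcond; apply: ge0_integral_mono => [y _|y _]; rewrite patchE.
  case: ifPn => // /[!inE] /phi0 y0; move: xA => /phi0; rewrite lee_fin => x0.
  by apply: mule_ge0 => //; rewrite lee_fin mulr_ge0// ltW.
case: ifPn => [/[!inE] yA|_]; last first.
  rewrite mule_ge0 ?lee_fin//.
  by apply: integral_ge0 => z _; rewrite lee_fin.
apply: (@le_trans _ _ ((k x y)%:E * (r / 3)%:E)%E).
  rewrite -!EFinM lee_fin cE (_ : _ * phi x * phi y =
    c3 * r `^ (gamma + 1) * (phi y * phi x) * (r / 3)); last by ring.
  rewrite ler_wpM2r ?divr_ge0 ?(ltW r0)//.
  exact: flux_density_annulus.
apply: lee_pmul; rewrite ?lee_fin ?divr_ge0 ?(ltW r0)//.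
have := xA; have := yA; rewrite /annulus/= !in_itv/= => /andP[ry yr] /andP[rx
  xr].
have sub : (`]r, (4 / 3 * r)[ : set M) `<=` `]x, (x + y)[.
  move=> z/=; rewrite !in_itv/= => /andP[rz zr].
  rewrite (le_lt_trans xr rz)/= (lt_le_trans zr)//; lra.
apply: (@le_trans _ _ (\int[mu]_(z in `]r, (4 / 3 * r)%R[) (g z)%:E)%E);
  last first.
  apply: ge0_subset_integral => //.
  - by apply/measurable_EFinP; exact: measurable_funTS.
  - by move=> z _; rewrite lee_fin.
rewrite (eq_integral (cst 1%E)); last first.
  move=> z /[!inE]/= /[!in_itv]/= /andP[rz zr]; rewrite /g indicE mem_set//=.
  by rewrite in_itv/= zr (lt_trans r0 rz).
rewrite integral_cst//= mul1e lebesgue_measure_itv/= lte_fin.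
rewrite (_ : r < 4 / 3 * r); last by lra.
by rewrite -EFinD lee_fin; lra.
Qed.

Lemma profile_annulus : exists2 C : R, 0 < C & forall r, 0 < r ->
  (\int[mu]_(x in `[(2 / 3 * r)%R, r]) (phi x)%:E <=
   (C * r `^ (- ((gamma + 1) / 2)))%:E)%E.
Proof.
(* Cancelling r/3 in [profile_annulus_sqr] leaves c3 r^(gamma + 1) P^2 <= 4 (1 + rho), where P is
   the integral of [phi] over the annulus. *)
pose C2 := (1 + rho) * 4 / c3.
have C20 : 0 < C2 by rewrite /C2 !mulr_gt0 ?invr_gt0// addr_gt0// rho_gt0.
exists (Num.sqrt C2) => [|r r0]; first by rewrite sqrtr_gt0.
have := profile_annulus_sqr r0; rewrite /annulus.
have : (0 <= \int[mu]_(x in `[(2 / 3 * r)%R, r]) (phi x)%:E)%E.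
  by apply: integral_ge0 => x /(annulus_gt0 r0) x0;
    rewrite lee_fin (profile_ge0 hphi).
case: (\int[mu]_(x in `[(2 / 3 * r)%R, r]) (phi x)%:E)%E => [P| |]//;
  last first.
  (* If the integral were infinite, the left-hand side of the bound would be too. *)
  by move=> _; rewrite gt0_muley ?gt0_muley// lte_fin !mulr_gt0 ?powR_gt0.
rewrite -!EFinM !lee_fin => P0.
(* A square root of r^(gamma + 1), so that the bound becomes one on (P q)^2. *)
pose q := r `^ ((gamma + 1) / 2).
have q0 : 0 < q by rewrite powR_gt0.
have -> : r `^ (gamma + 1) = q * q.
  by rewrite /q -powRD ?(gt_eqF r0) ?implybT// -splitr.
move=> H; rewrite powRN -/q ler_pdivlMr//.
rewrite -[leLHS]ger0_norm ?mulr_ge0 ?(ltW q0)// -sqrtr_sqr ler_sqrt ?(ltW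
  C20)//.
rewrite /C2 ler_pdivlMr// -(ler_pM2r (x := r / 3)) ?divr_gt0//.
by move: H; congr (_ <= _); rewrite ?expr2; ring.
Qed.

Lemma moment_annulus (a : R) : exists2 C : R, 0 < C & forall r, 0 < r ->
  (\int[mu]_(x in `[(2 / 3 * r)%R, r]) (x `^ a * phi x)%:E <=
   (C * r `^ (a - (gamma + 1) / 2))%:E)%E.
Proof.
have [C C0 HC] := profile_annulus.
exists ((3 / 2) `^ `|a| * C) => [|r r0]; first by rewrite mulr_gt0 ?powR_gt0.
have phi0 y : annulus r y -> (0 <= (phi y)%:E)%E.
  by move=> /(annulus_gt0 r0) y0; rewrite lee_fin (profile_ge0 hphi).
apply: (@le_trans _ _ (\int[mu]_(x in `[(2 / 3 * r)%R, r])
    (((3 / 2) `^ `|a| * r `^ a)%:E * (phi x)%:E))%E).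
  apply: ge0_integral_mono => x xA; have := phi0 x xA; rewrite lee_fin => x0.
    by rewrite lee_fin mulr_ge0 ?powR_ge0.
  rewrite -EFinM lee_fin ler_wpM2r//.
  by move: xA; rewrite /= in_itv/= => /andP[? ?]; exact: powR_annulus_le.
rewrite ge0_integralZl ?lee_fin ?mulr_ge0 ?powR_ge0//; last first.
  by apply/measurable_EFinP; exact: measurable_annulus_phi.
rewrite powRD ?(gt_eqF r0) ?implybT//.
rewrite (_ : _ * C * _ = (3 / 2) `^ `|a| * r `^ a * (C * r `^ (- ((gamma + 1) /
  2)))).
  by rewrite [leRHS]EFinM lee_pmul ?lee_fin ?mulr_ge0 ?powR_ge0 ?integral_ge0
    ?HC.
by ring.
Qed.

Let moment_ge0 a (x : R) : 0 < x -> (0 <= (x `^ a * phi x)%:E)%E.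
Proof. by move=> x0; rewrite lee_fin mulr_ge0 ?powR_ge0 ?(profile_ge0 hphi).
  Qed.

Let subitv (b1 : R) B : 0 <= b1 ->
  [set` Interval (BRight b1) B] `<=` (`]0, +oo[%classic : set R).
Proof.
by move=> b10 x; rewrite /= !in_itv/= andbT => /andP[bx _];
  exact: le_lt_trans bx.
Qed.

(** On ]0, 1] the annuli with r = (2/3)^n contribute terms of a geometric series, convergent because
    a > (gamma + 1) / 2. Beyond 1 the condition a <= 1 lets the first moment dominate. *)
Lemma integrable_moment (a : R) : (gamma + 1) / 2 < a -> a <= 1 ->
  mu.-integrable `]0, +oo[ (fun x => (x `^ a * phi x)%:E).
Proof.
move=> ga a1.
have mf : measurable_fun (`]0, +oo[%classic : set M)
    (fun x => (x `^ a * phi x)%:E).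
  by apply/measurable_EFinP; exact: measurable_moment hphi _.
have f0 x : (`]0, +oo[%classic : set R) x -> (0 <= (x `^ a * phi x)%:E)%E.
  by rewrite /= in_itv/= andbT; exact: moment_ge0.
have [C C0 HC] := moment_annulus a.
(* The ratio of the geometric series. *)
pose th : R := (2 / 3) `^ (a - (gamma + 1) / 2).
have th0 : 0 < th by rewrite powR_gt0.
have th1 : th < 1.
  suff : th < 1 `^ (a - (gamma + 1) / 2) by rewrite powR1.
  apply: gt0_ltr_powR.
  - by rewrite subr_gt0.
  - by rewrite nnegrE divr_ge0.
  - by rewrite nnegrE.
  - by lra.
pose F n : set M := `](2 / 3) ^+ n, 1]%classic.
have p0 n : 0 < (2 / 3) ^+ n :> R by rewrite exprn_gt0.
have sF n : F n `<=` `]0, +oo[ by apply: subitv; exact: ltW.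
have mF n : measurable (F n) by exact: measurable_itv.
(* The bound is the partial sum of C th^k for k < n; passing from [n] to [n.+1] adds the annulus
   with r = (2/3)^n. *)
have SF n : (\int[mu]_(x in F n) (x `^ a * phi x)%:E <=
    (C / (1 - th) * (1 - th ^+ n))%:E)%E.
  elim: n => [|n ih].
    by rewrite /F expr0 set_itv_ge ?integral_set0 ?subrr ?mulr0// bnd_simp ltxx.
  have -> : F n.+1 = `](2 / 3) ^+ n.+1, (2 / 3) ^+ n] `|` F n.
    rewrite /F (@itv_bndbnd_setU _ _ _ (BRight ((2 / 3) ^+ n)))// bnd_simp.
      rewrite exprS ler_piMl ?(ltW (p0 n))//; lra.
    by rewrite exprn_ile1//; lra.
  rewrite ge0_integral_setU//=.
  - rewrite (_ : C / (1 - th) * (1 - th ^+ n.+1) =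
       C * th ^+ n + C / (1 - th) * (1 - th ^+ n)); last first.
      by rewrite exprS; field; rewrite subr_eq0 gt_eqF.
    rewrite EFinD leeD//; apply: le_trans (le_trans (HC _ (p0 n)) _).
      apply: ge0_subset_integral => //=.
      + apply: measurable_funS mf => // x /=;
        rewrite !in_itv/= andbT => /andP[xx _].
        by rewrite (lt_le_trans _ xx)// mulr_gt0.
      + by move=> x /(annulus_gt0 (p0 n)); exact: moment_ge0.
      + move=> x /=; rewrite !in_itv/= exprS => /andP[/ltW -> ->//].
    have -> : ((2 / 3) ^+ n) `^ (a - (gamma + 1) / 2) = th ^+ n.
      rewrite -(powR_mulrn n (ltW th0)) /th powRAC.
      by rewrite (powR_mulrn n (_ : 0 <= 2 / 3))// divr_ge0.
    by [].
  - apply: measurable_funS mf => //; rewrite subUset; split => //.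
    by apply: subitv; exact: ltW.
  - by move=> x [xF|/sF]; apply: f0 => //; apply: subitv xF; exact: ltW.
  - apply/disj_setPRL => x /=; rewrite /F/= !in_itv/= => /andP[xn _].
    by apply/negP; rewrite negb_and -!ltNge xn orbT.
apply/integrableP; split => //.
rewrite (eq_integral (fun x : M => (x `^ a * phi x)%:E)); last first.
  by move=> x /[!inE] /f0 fx; rewrite gee0_abs.
have -> : `]0, +oo[%classic = (`]0, 1] `|` `]1, +oo[ : set M).
  by rewrite -itv_bndbnd_setU// bnd_simp.
rewrite ge0_integral_setU//=; last 3 first.
- apply: measurable_funS mf => //; rewrite subUset.
  by split; apply: subitv.
- by move=> x [xF|xF]; apply: f0 => //; apply: subitv xF.
- apply/disj_setPRL => x /=; rewrite !in_itv/= andbT => x1.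
  by apply/negP; rewrite negb_and -!ltNge x1 orbT.
apply: lte_add_pinfty.
  apply: (@le_lt_trans _ _ (C / (1 - th))%:E); last by rewrite ltry.
  have -> : `]0, 1]%classic = \bigcup_n F n.
    apply/seteqP; split => [x|x [n _]]; last first.
      by rewrite /F/= !in_itv/= => /andP[xn ->]; rewrite (lt_trans _ xn).
    rewrite /= in_itv/= => /andP[x0 x1].
    have : (2 / 3 : R) ^+ n @[n --> \oo] --> 0.
      by apply: cvg_expr; rewrite ger0_norm ?divr_ge0//; lra.
    move=> /cvgrPdist_lt/(_ _ x0)[n _ /(_ n (leqnn n))].
    rewrite sub0r normrN ger0_norm ?(ltW (p0 n))// => xn.
    by exists n => //; rewrite /F/= in_itv/= xn.
  have ndF : nondecreasing_seq F.
    move=> m n mn; rewrite subsetEset => x;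
      rewrite /F/= !in_itv/= => /andP[xm ->].
    rewrite (le_lt_trans _ xm)//; apply: ler_wiXn2l => //; lra.
  have cvF := ge0_nondecreasing_set_cvg_integral (mu := mu) ndF mF
    (fun n => measurable_funS (measurable_itv _) (@sF n) mf)
    (fun n x Fx => f0 x (@sF n x Fx)).
  rewrite -(cvg_lim _ cvF)//; apply: lime_le; first by apply/cvg_ex; eexists;
    exact: cvF.
  apply: nearW => n; apply: (le_trans (SF n)).
  rewrite lee_fin ler_piMr ?divr_ge0 ?subr_ge0 ?(ltW C0) ?(ltW th1)//.
  by rewrite gerBl exprn_ge0// ltW.
apply: (@le_lt_trans _ _ 1%E); last by rewrite ltry.
rewrite -(profile_mass hphi).
have s1 : (`]1, +oo[ : set M) `<=` `]0, +oo[ by exact: subitv.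
apply: (@le_trans _ _ (\int[mu]_(x in `]1%R, +oo[) (x * phi x)%:E)%E).
  apply: ge0_integral_mono => x x1; first by apply: f0; exact: s1.
  have /f0 := s1 _ x1; have := s1 _ x1; rewrite /= in_itv/= andbT => x0 _.
  rewrite lee_fin ler_wpM2r ?(profile_ge0 hphi)//.
  move: x1; rewrite /= in_itv/= andbT => /ltW x1.
  by rewrite -[leRHS]powRr1 ?(ltW x0)// ler_powR.
apply: ge0_subset_integral => //.
- by apply/measurable_EFinP; exact: measurable_mass hphi.
- by move=> x x0; rewrite lee_fin (mass_integrand_ge0 hphi).
Qed.

End profile_moments.

(** * The weak form of the profile equation *)

Section interval_integral.
Context (R : realType).
Local Notation mu := (@lebesgue_measure R).
Local Notation M := (measurableTypeR R).
Local Open Scope ereal_scope.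

(** Moving the variable endpoints into the integrand turns this into the measurability part of
    Tonelli's theorem. *)
Lemma measurable_interval_integral (g : M -> R) : measurable_fun setT g ->
  (forall z, 0 <= g z)%R ->
  measurable_fun [set: M * M]
    (fun w : M * M => \int[mu]_(z in `]w.1, (w.1 + w.2)%R[) (g z)%:E).
Proof.
move=> mg g0.
pose G (w : (M * M) * M) : \bar R :=
  (if (w.1.1 < w.2 < w.1.1 + w.1.2)%R then g w.2 else 0%R)%:E.
rewrite (_ : (fun _ => _) = fubini_F mu G); last first.
  apply/funext => w; rewrite /fubini_F [LHS]integral_mkcond;
    apply: eq_integral => z _.
  rewrite patchE (_ : (z \in `]w.1, (w.1 + w.2)%R[%classic) = (w.1 < z < w.1 +
    w.2)%R).
    by rewrite /G/=; case: ifP.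
  by apply/idP/idP; rewrite inE/= in_itv.
apply: measurable_fun_fubini_tonelli_F; last first.
  by move=> w; rewrite /G lee_fin; case: ifP.
have m11 : measurable_fun [set: (M * M) * M] (fun w => w.1.1).
  exact: (measurableT_comp measurable_fst measurable_fst).
have m12 : measurable_fun [set: (M * M) * M] (fun w => w.1.2).
  exact: (measurableT_comp measurable_snd measurable_fst).
have m2 : measurable_fun [set: (M * M) * M] (fun w => w.2).
  exact: measurable_snd.
apply/measurable_EFinP; apply: measurable_fun_if => //.
  apply: measurable_and; first exact: measurable_fun_ltr.
  by apply: measurable_fun_ltr => //; exact: measurable_funD.
exact: measurable_funTS (measurableT_comp mg m2).
Qed.

Lemma interval_integral_ge0 (g : M -> R) (D : set M) : (forall z, 0 <= g z)%R ->
  0 <= \int[mu]_(z in D) (g z)%:E.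
Proof. by move=> g0; apply: integral_ge0 => z _; rewrite lee_fin. Qed.

End interval_integral.

Section flux_identity.
Context (R : realType) (gamma : R) (K : R -> R -> R) (phi : R -> R).
Local Notation mu := (@lebesgue_measure R).
Local Notation M := (measurableTypeR R).
Hypothesis hgamma : gamma < 1.
Hypothesis Kcont : {within `]0, +oo[ `*` `]0, +oo[,
                continuous (fun p : R * R => K p.1 p.2)}.
Hypothesis Kge0 : forall x y : R, 0 < x -> 0 < y -> 0 <= K x y.
Hypothesis Khom : homogeneous_kernel gamma K.
Hypothesis hphi : self_similar_profile gamma K phi.
Local Notation k := (flux_density K phi).
Local Notation rho := (2 / (1 - gamma)).
Local Open Scope ereal_scope.

Let mass_ge0 (x : R) : (`]0%R, +oo[%classic : set R) x -> 0 <= (x * phi x)%:E.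
Proof. by move=> x0; rewrite lee_fin (mass_integrand_ge0 hphi). Qed.

(** The unit mass turns the first two terms of the profile equation into one nonnegative integral,
    to which Tonelli's theorem applies. *)
Lemma mass_tail (z : R) : (0 < z)%R ->
  1 - \int[mu]_(x in `]0%R, z[) (x * phi x)%:E =
  \int[mu]_(x in `[z, +oo[) (x * phi x)%:E.
Proof.
move=> z0; rewrite -(profile_mass hphi).
have -> : `]0%R, +oo[%classic = (`]0%R, z[ `|` `[z, +oo[ : set M).
  by rewrite -itv_bndbnd_setU// bnd_simp ltW.
rewrite ge0_integral_setU//=.
- by rewrite addeAC subee ?add0e//; exact: partial_mass_fin_num hphi _.
- rewrite -itv_bndbnd_setU ?bnd_simp// ?ltW//.
  by apply/measurable_EFinP; exact: measurable_mass hphi.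
- move=> x [|] /=; rewrite !in_itv/=.
    by move=> /andP[x0 _]; apply: mass_ge0; rewrite /= in_itv/= x0.
  rewrite andbT => zx; apply: mass_ge0.
  by rewrite /= in_itv/= andbT (lt_le_trans z0).
- apply/disj_setPRL => x /=; rewrite !in_itv/= andbT => zx.
  by apply/negP; rewrite negb_and -!leNgt zx orbT.
Qed.

(** The profile equation multiplied by [g] and integrated. The flux side is rewritten by
    [integral_crossing_integral]; on the other side, exchanging integrals in the tail of the mass
    produces the integral of [g] over ]0, x[. It is used for [g] the positive and the negative part
    of a derivative. *)
Lemma flux_identity (g : M -> R) : measurable_fun setT g ->
  (forall z, 0 <= g z)%R ->
  \int[mu]_x \int[mu]_y ((k x y)%:E * \int[mu]_(z in `]x, (x + y)%R[) (g z)%:E)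
    =
  \int[mu]_(x in `]0%R, +oo[)
    ((x * phi x)%:E * (\int[mu]_(z in `]0%R, x[) (g z)%:E + (rho * x * g
      x)%:E)).
Proof.
move=> mg g0.
have mkk := measurable_flux_density Kcont Khom hphi.
have kk0 := flux_density_ge0 Kge0 hphi.
have mc := measurable_crossing_integral mkk kk0.
have mEg : measurable_fun [set: M] (EFin \o g) by exact/measurable_EFinP.
have mm := measurable_mass hphi.
have rho0 := rho_gt0 hgamma.
have mEm : measurable_fun (`]0%R, +oo[%classic : set M) (fun x => (x * phi
  x)%:E).
  exact/measurable_EFinP.
pose m0 : M -> \bar R := (fun x => (x * phi x)%:E) \_ (`]0%R, +oo[%classic :
  set M).
have mm0 : measurable_fun setT m0.
  exact/(measurable_restrictT _ (measurable_itv _)).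
have m00 x : 0 <= m0 x.
  by rewrite /m0 patchE; case: ifPn => // /[!inE]; exact: mass_ge0.
have q0 z : (0 < z)%R -> (0 <= rho * z ^+ 2 * phi z)%R.
  by move=> z0; rewrite mulr_ge0 ?(profile_ge0 hphi)// mulr_ge0 ?sqr_ge0 ?(ltW
    rho0).
rewrite -integral_crossing_integral//.
pose tail (z : M) := \int[mu]_x (if (z <= x)%R then m0 x else 0).
have mtail2 : measurable_fun [set: M * M] (fun w : M * M =>
    (if (w.1 <= w.2)%R then m0 w.2 else 0)).
  apply: measurable_fun_if => //; first exact: measurable_fun_ler.
  by apply: measurable_funTS; exact: (measurableT_comp mm0).
have tail20 (w : M * M) : 0 <= (if (w.1 <= w.2)%R then m0 w.2 else 0).
  by case: ifP.
have mtail : measurable_fun setT tail.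
  exact: (measurable_fun_fubini_tonelli_F (m2 := mu) (fun w : M * M =>
    (if (w.1 <= w.2)%R then m0 w.2 else 0))).
have tail0 z : 0 <= tail z.
  by apply: integral_ge0 => x _; exact: (tail20 (z, x)).
have tailE z : (0 < z)%R -> \int[mu]_(x in `[z, +oo[) (x * phi x)%:E = tail z.
  move=> z0; rewrite /tail integral_mkcond; apply: eq_integral => x _.
  rewrite patchE (_ : (x \in `[z, +oo[%classic) = (z <= x)%R); last first.
    by apply/idP/idP; rewrite inE/= in_itv/= andbT.
  case: ifP => // zx; rewrite /m0 patchE mem_set//= in_itv/= andbT.
  exact: lt_le_trans zx.
transitivity (\int[mu]_(z in `]0%R, +oo[)
    ((g z)%:E * tail z + (g z * (rho * z ^+ 2 * phi z))%:E)).
  transitivity (\int[mu]_(z in `]0%R, +oo[) ((g z)%:E * crossing_integral k z)).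
    rewrite [RHS]integral_mkcond; apply: eq_integral => z _; rewrite patchE.
    case: ifPn => //; rewrite notin_setE/= in_itv/= andbT => /negP.
    by rewrite -leNgt => z0; rewrite crossing_flux_density_le0 ?mule0.
  (* The profile equation holds only almost everywhere, which is enough under the integral. *)
  apply: ae_eq_integral => //.
  - by apply: measurable_funTS; exact: emeasurable_funM.
  - apply: emeasurable_funD; first by apply: measurable_funTS;
    exact: emeasurable_funM.
    apply/measurable_EFinP; apply: measurable_funM;
      first exact: measurable_funTS.
    by apply: measurable_funM; [exact: measurable_funM|exact:
      measurable_profile hphi].
  have aeF := ae_filter_ringOfSetsType mu.
  apply: (@filterS _ _ aeF _ _ _ (profile_flux_eq hphi)) => z Hz.
  rewrite /= in_itv/= andbT => z0.
  rewrite -flux_crossing// Hz// mass_tail// tailE// ge0_muleDr//.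
  by rewrite lee_fin q0.
rewrite ge0_integralD//=; last 4 first.
- by move=> z z0; rewrite mule_ge0 ?lee_fin.
- by apply: measurable_funTS; exact: emeasurable_funM.
- move=> z /=; rewrite in_itv/= andbT => z0.
  by rewrite lee_fin mulr_ge0// q0.
- apply/measurable_EFinP; apply: measurable_funM; first exact: measurable_funTS.
  by apply: measurable_funM; [exact: measurable_funM|exact: measurable_profile
    hphi].
have mint : measurable_fun [set: M] (fun x : M => \int[mu]_(z in `]0%R, x[) (g
  z)%:E).
  have := measurableT_comp (measurable_interval_integral mg g0)
    (pair1_measurable (0%R : M)).
  by apply: eq_measurable_fun => x _ /=; rewrite add0r.
transitivity (\int[mu]_(x in `]0%R, +oo[)
    ((x * phi x)%:E * \int[mu]_(z in `]0%R, x[) (g z)%:E)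
  + \int[mu]_(x in `]0%R, +oo[) (g x * (rho * x ^+ 2 * phi x))%:E); last first.
  rewrite -ge0_integralD//=; last 4 first.
  - by move=> x x0; rewrite mule_ge0 ?mass_ge0 ?interval_integral_ge0.
  - by apply: emeasurable_funM => //; exact: measurable_funTS.
  - move=> z /=; rewrite in_itv/= andbT => z0.
    by rewrite lee_fin mulr_ge0// q0.
  - apply/measurable_EFinP; apply: measurable_funM;
    first exact: measurable_funTS.
    by apply: measurable_funM; [exact: measurable_funM|exact:
      measurable_profile hphi].
  apply: eq_integral => x /[!inE]/= /[!in_itv]/= /[!andbT] x0.
  rewrite [RHS]ge0_muleDr; [|exact: interval_integral_ge0|]; last first.
    by rewrite lee_fin mulr_ge0// mulr_ge0 ?(ltW rho0)// ltW.
  by rewrite -EFinM; congr (_ + _%:E); ring.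
apply: (congr1 (fun z => z + _)); rewrite integral_mkcond.
(* [g] is cut off at 0 so that the integral in [z] can run over the whole line. *)
pose g1 : M -> R := g \_ (`]0%R, +oo[%classic : set M).
have mg1 : measurable_fun [set: M] g1.
  by apply/(measurable_restrictT _ (measurable_itv _)); exact: measurable_funTS.
have g10 z : (0 <= g1 z)%R by rewrite /g1 patchE; case: ifP.
transitivity (\int[mu]_z \int[mu]_x
    ((g1 z)%:E * (if (z <= x)%R then m0 x else 0))).
  apply: eq_integral => z _; rewrite patchE/= /g1 patchE.
  case: ifP => _; last first.
    by rewrite integral0_eq// => x _; rewrite mul0e.
  rewrite ge0_integralZl// ?lee_fin//.
    exact: (measurableT_comp mtail2 (pair1_measurable z)).
  by move=> x _; exact: (tail20 (z, x)).
rewrite (fubini_tonelli (m1 := mu) (m2 := mu) (fun w : M * M => (g1 w.1)%:E * 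
   (if (w.1 <= w.2)%R then m0 w.2 else 0))); last 2 first.
- apply: emeasurable_funM => //; apply/measurable_EFinP.
  exact: (measurableT_comp mg1).
- by move=> w; rewrite mule_ge0 ?lee_fin.
rewrite [RHS]integral_mkcond; apply: eq_integral => x _ /=.
rewrite patchE; case: ifPn => [/[!inE]/= x0|x0]; last first.
  by apply: integral0_eq => z _; rewrite /m0 patchE (negbTE x0); case: ifP;
    rewrite mule0.
(* The tail contains its endpoint, so the exchanged integral runs over z <= x; the single point [x]
   is negligible. *)
have -> : \int[mu]_(z in `]0%R, x[) (g z)%:E = \int[mu]_(z in `]0%R, x]) (g
  z)%:E.
  by rewrite -integral_itv_bndo_bndc//; exact: measurable_funTS.
rewrite -ge0_integralZl ?mass_ge0//; last 2 first.
- exact: measurable_funTS.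
- by move=> z _; rewrite lee_fin.
rewrite [RHS]integral_mkcond; apply: eq_integral => z _.
rewrite patchE /g1 /m0 !patchE (_ : x \in _)//; last exact/mem_set.
rewrite (_ : (z \in `]0%R, x]%classic) = (0 < z <= x)%R); last first.
  by apply/idP/idP; rewrite inE/= in_itv.
rewrite (_ : (z \in `]0%R, +oo[%classic) = (0 < z)%R); last first.
  by apply/idP/idP; rewrite inE/= in_itv/= andbT.
by case: (0 < z)%R; case: (z <= x)%R; rewrite ?mul0e ?mule0//= muleC.
Qed.

End flux_identity.

(** The integral is by definition the difference of those of the positive and negative parts, and
    Tonelli's theorem gives measurability of each; integrability plays no part. *)
Lemma measurable_integral_section d1 d2 (T1 : measurableType d1)
    (T2 : measurableType d2) (R : realType)
    (m : {sigma_finite_measure set T2 -> \bar R}) (f : T1 * T2 -> \bar R) :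
  measurable_fun setT f -> measurable_fun setT (fun x => \int[m]_y f (x, y))%E.
Proof.
move=> mf.
rewrite (_ : (fun _ => _) =
    (fubini_F m (f^\+)%E \- fubini_F m (f^\-)%E)%E); last first.
  apply/funext => x; rewrite integralE/= /fubini_F; congr (_ - _)%E.
    by apply: eq_integral => y _; rewrite !funeposE.
  by apply: eq_integral => y _; rewrite !funenegE.
apply: emeasurable_funB; apply: measurable_fun_fubini_tonelli_F => //.
  exact: measurable_funepos.
exact: measurable_funeneg.
Qed.

(** * Measurability of the collision integrand *)

Section collision_measurability.
Context (R : realType) (gamma : R) (K : R -> R -> R) (V : R -> R).
Local Notation M := (measurableTypeR R).
Hypothesis Kcont : {within `]0, +oo[ `*` `]0, +oo[,
                continuous (fun p : R * R => K p.1 p.2)}.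
Hypothesis Khom : homogeneous_kernel gamma K.
Hypothesis mV : measurable_fun [set: M] V.

(** The pair is read as (y, x), the order in which the two integrals are nested. *)
Lemma measurable_collision : measurable_fun [set: M * M] (fun w : M * M =>
  if (0 < w.1) && (0 < w.2) then
    K w.1 w.2 * ((w.2 + w.1) * V (w.2 + w.1) - w.2 * V w.2 - w.1 * V w.1)
  else 0).
Proof.
have mK := measurable_homogeneous_kernel Khom Kcont.
rewrite (_ : (fun _ => _) = (fun w : M * M =>
    (if (0 < w.1) && (0 < w.2) then K w.1 w.2 else 0) *
    ((w.2 + w.1) * V (w.2 + w.1) - w.2 * V w.2 - w.1 * V w.1))); last first.
  by apply/funext => w; case: ifP; rewrite ?mul0r.
have m1 : measurable_fun [set: M * M] (fun w : M * M => w.1).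
  exact: measurable_fst.
have m2 : measurable_fun [set: M * M] (fun w : M * M => w.2).
  exact: measurable_snd.
have m21 : measurable_fun [set: M * M] (fun w : M * M => w.2 + w.1 : M).
  exact: measurable_funD.
have mM (h : M * M -> M) : measurable_fun setT h ->
    measurable_fun setT (fun w => h w * V (h w)).
  by move=> mh; apply: measurable_funM => //; exact: (measurableT_comp mV).
apply: measurable_funM => //; apply: measurable_funB.
  by apply: measurable_funB; [exact: (mM (fun w => w.2 + w.1))|exact: (mM snd)].
exact: (mM fst).
Qed.

Lemma measurable_collision_section (y : R) : 0 < y ->
  measurable_fun (`]0, +oo[%classic : set M)
    (fun x => K y x * ((x + y) * V (x + y) - x * V x - y * V y)).
Proof.
move=> y0; have := measurableT_comp measurable_collision (pair1_measurable (y :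
  M)).
move=> /(@measurable_funTS _ _ _ _ (`]0, +oo[%classic : set M)).
apply: eq_measurable_fun => x /[!inE]/= /[!in_itv]/= /[!andbT] x0.
by rewrite y0 x0.
Qed.

End collision_measurability.

(** * Testing the profile equation with a derivative and symmetrizing *)

Section stationary_weak_identity.
Context (R : realType) (gamma : R) (K : R -> R -> R) (phi : R -> R).
Local Notation mu := (@lebesgue_measure R).
Local Notation M := (measurableTypeR R).
Hypothesis hgamma : gamma < 1.
Hypothesis Kcont : {within `]0, +oo[ `*` `]0, +oo[,
                continuous (fun p : R * R => K p.1 p.2)}.
Hypothesis Kge0 : forall x y : R, 0 < x -> 0 < y -> 0 <= K x y.
Hypothesis Ksym : forall x y : R, 0 < x -> 0 < y -> K x y = K y x.
Hypothesis Khom : homogeneous_kernel gamma K.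
Hypothesis hphi : self_similar_profile gamma K phi.
Local Notation k := (flux_density K phi).
Local Notation rho := (2 / (1 - gamma)).

Variables (f f' : R -> R) (N C : R).
Hypothesis cf : continuous f.
Hypothesis cf' : continuous f'.
Hypothesis df : forall x : R, 0 < x -> is_derive x 1 f (f' x).
Hypothesis f_supp : forall x : R, 0 < x -> N < x -> f' x = 0.
Hypothesis f'_bnd : forall x : R, 0 < x -> `|f' x| <= C.
Hypothesis N0 : 0 < N.

Let C0 : 0 <= C.
Proof. by rewrite (le_trans _ (f'_bnd ltr01)). Qed.

(** The fundamental theorem of calculus with the two signs of [f'] kept apart, since [flux_identity]
    takes nonnegative functions only. *)
Lemma integral_derivative (x y : R) : 0 <= x -> x < y ->
  (\int[mu]_(z in `]x, y[) (f'^\+ z)%:E - \int[mu]_(z in `]x, y[) (f'^\- z)%:E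
   = (f y - f x)%:E)%E.
Proof.
move=> x0 xy; rewrite EFinB; have := @continuous_FTC2 R f' f x y xy.
rewrite integral_itv_bndoo; last first.
  apply: measurable_funTS; apply/measurable_EFinP.
  exact: continuous_measurable_fun.
move=> <-.
- by rewrite [RHS]integralE funerpos funerneg.
- exact: continuous_subspaceT.
- split.
  + move=> z; rewrite in_itv/= => /andP[xz _].
    by have [] := df (le_lt_trans x0 xz).
  + by apply: cvg_at_right_filter; exact: cf.
  + by apply: cvg_at_left_filter; exact: cf.
- move=> z; rewrite in_itv/= => /andP[xz _].
  by rewrite derive1E; have [_ ->] := df (le_lt_trans x0 xz).
Qed.

(** What the positive and negative parts of [f'] have in common; it makes both sides of
    [flux_identity] finite. *)
Definition bounded_cutoff (g : R -> R) := [/\ measurable_fun [set: M] g,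
  forall z, 0 <= g z, forall z : R, 0 < z -> g z <= C &
  forall z : R, 0 < z -> N < z -> g z = 0].

Let cutoff_pos : bounded_cutoff f'^\+.
Proof.
split.
- by apply: measurable_funrpos; exact: continuous_measurable_fun.
- by move=> z; exact: funrpos_ge0.
- move=> z z0; rewrite /funrpos ge_max C0 andbT.
  exact: le_trans (ler_norm _) (f'_bnd z0).
- by move=> z z0 Nz; rewrite /funrpos f_supp// maxxx.
Qed.

Let cutoff_neg : bounded_cutoff f'^\-.
Proof.
split.
- by apply: measurable_funrneg; exact: continuous_measurable_fun.
- by move=> z; exact: funrneg_ge0.
- move=> z z0; rewrite /funrneg ge_max C0 andbT.
  by rewrite (le_trans (ler_norm _))// normrN f'_bnd.
- by move=> z z0 Nz; rewrite /funrneg f_supp// oppr0 maxxx.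
Qed.

Section cutoff.
Variable g : R -> R.
Hypothesis hg : bounded_cutoff g.

Lemma cutoff_interval_le (x y : R) : 0 <= x -> 0 <= y ->
  (\int[mu]_(z in `]x, y[) (g z)%:E <= (C * N)%:E)%E.
Proof.
have [mg g0 gC gN] := hg.
move=> x0 y0.
apply: (@le_trans _ _ (\int[mu]_(z in `]0%R, N]) (g z)%:E)%E).
  rewrite integral_mkcond [leRHS]integral_mkcond.
  apply: ge0_integral_mono => z _; rewrite !patchE.
    by case: ifP => // _; rewrite lee_fin.
  case: ifPn => [/[!inE]/=|_]; last by case: ifP => // _; rewrite lee_fin.
  rewrite in_itv/= => /andP[xz zy].
  have z0 := le_lt_trans x0 xz.
  have [zN|zN] := leP z N; last by rewrite gN//; case: ifP.
  by rewrite mem_set//= in_itv/= z0.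
apply: (@le_trans _ _ (\int[mu]_(z in `]0%R, N]) (cst C%:E) z)%E).
  by apply: ge0_integral_mono => z /=;
    rewrite lee_fin// in_itv/= => /andP[z0 _]; exact: gC.
rewrite integral_cst//= lebesgue_measure_itv/= lte_fin N0.
by rewrite oppr0 adde0 EFinM.
Qed.

Lemma cutoff_interval_fin_num (x y : R) : 0 <= x -> 0 <= y ->
  (\int[mu]_(z in `]x, y[) (g z)%:E)%E \is a fin_num.
Proof.
move=> x0 y0; have [mg g0 gC gN] := hg.
rewrite ge0_fin_numE ?interval_integral_ge0//.
by rewrite (le_lt_trans (cutoff_interval_le x0 y0))// ltry.
Qed.

(** Since x g(x) <= N C, the factor of x phi(x) is bounded, and the unit mass dominates. *)
Lemma cutoff_mass_integrable :
  mu.-integrable `]0, +oo[ (fun x =>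
    ((x * phi x)%:E * (\int[mu]_(z in `]0%R, x[) (g z)%:E + (rho * x * g
      x)%:E)))%E.
Proof.
have [mg g0 gC gN] := hg.
have rho0 := rho_gt0 hgamma.
have mint : measurable_fun [set: M] (fun x : M => \int[mu]_(z in `]0%R, x[) (g
  z)%:E)%E.
  have := measurableT_comp (measurable_interval_integral mg g0)
    (pair1_measurable (0%R : M)).
  by apply: eq_measurable_fun => x _ /=; rewrite add0r.
apply: (@le_integrable _ _ _ mu _ (measurable_itv _) _
    (fun x => (C * N + rho * (N * C))%:E * (x * phi x)%:E)%E).
- apply: emeasurable_funM; first by apply/measurable_EFinP;
  exact: measurable_mass hphi.
  apply: measurable_funTS; apply: emeasurable_funD => //.
  by apply/measurable_EFinP; apply: measurable_funM => //;
    exact: measurable_funM.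
- move=> x x0; have m0 := mass_integrand_ge0 hphi x0.
  move: x0; rewrite /= in_itv/= andbT => x0.
  have I0 := interval_integral_ge0 (`]0, x[%classic) g0.
  have S0 : 0 <= rho * x * g x by rewrite mulr_ge0// mulr_ge0// ltW.
  have CN0 : 0 <= C * N + rho * (N * C).
    by apply: addr_ge0; [|apply: mulr_ge0; [exact: ltW|]];
      apply: mulr_ge0 => //; exact: ltW.
  rewrite gee0_abs; last first.
    by apply: mule_ge0; [rewrite lee_fin|apply: adde_ge0; [|rewrite lee_fin]].
  rewrite ger0_norm ?(mulr_ge0 CN0 m0)// (mulrC (C * N + _)) [leRHS]EFinM.
  apply: lee_wpmul2l; first by rewrite lee_fin.
  rewrite EFinD leeD//; first by rewrite cutoff_interval_le// ltW.
  rewrite lee_fin -(mulrA rho x) ler_wpM2l ?(ltW rho0)//.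
  have [xN|xN] := leP x N; last by rewrite gN// mulr0 mulr_ge0// ltW.
  by apply: ler_pM => //; [exact: ltW|exact: gC].
- apply: integrableZl => //; apply/integrableP; split.
    by apply/measurable_EFinP; exact: measurable_mass hphi.
  rewrite (eq_integral (fun x : M => (x * phi x)%:E)); last first.
    by move=> x /[!inE] x0; rewrite gee0_abs// lee_fin (mass_integrand_ge0
      hphi).
  by rewrite (profile_mass hphi) ltry.
Qed.

Let W (w : M * M) : \bar R :=
  ((k w.1 w.2)%:E * \int[mu]_(z in `]w.1, (w.1 + w.2)%R[) (g z)%:E)%E.

(** Finiteness is read off the other side of [flux_identity]; no upper bound on the kernel
    enters. *)
Lemma cutoff_flux_integrable : (mu \x mu)%E.-integrable setT W.
Proof.
have [mg g0 gC gN] := hg.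
have mkk := measurable_flux_density Kcont Khom hphi.
have kk0 := flux_density_ge0 Kge0 hphi.
have W0 w : (0 <= W w)%E by rewrite mule_ge0 ?lee_fin// interval_integral_ge0.
have mW : measurable_fun setT W.
  apply: emeasurable_funM; first exact/measurable_EFinP.
  exact: measurable_interval_integral.
apply/integrableP; split => //.
under eq_integral do rewrite gee0_abs//.
rewrite fubini_tonelli1//.
rewrite [ltLHS](flux_identity hgamma Kcont Kge0 Khom hphi mg g0).
exact: integrable_lty cutoff_mass_integrable.
Qed.

Lemma cutoff_flux_integral :
  (\int[mu \x mu]_w W w = \int[mu]_(x in `]0%R, +oo[)
    ((x * phi x)%:E * (\int[mu]_(z in `]0%R, x[) (g z)%:E + (rho * x * g
      x)%:E)))%E.
Proof.
have [mg g0 gC gN] := hg.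
rewrite -(integral12_prod_meas1 cutoff_flux_integrable).
exact: flux_identity.
Qed.

End cutoff.

Let D (w : M * M) : R := k w.1 w.2 * (f (w.1 + w.2) - f w.1).

(** On the open quadrant both integrals are finite, so the product distributes over their
    difference; elsewhere [k] is 0. *)
Let DE w : (D w)%:E =
  ((k w.1 w.2)%:E * (\int[mu]_(z in `]w.1, (w.1 + w.2)%R[) (f'^\+ z)%:E) -
   (k w.1 w.2)%:E * (\int[mu]_(z in `]w.1, (w.1 + w.2)%R[) (f'^\- z)%:E))%E.
Proof.
rewrite /D; case: w => x y/=.
have [/andP[x0 y0]|xy] := boolP ((0 < x) && (0 < y)); last first.
  by rewrite /flux_density (negbTE xy) mul0r !mul0e sube0.
rewrite EFinM -integral_derivative ?ltrDl ?(ltW x0)//.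
have xy0 : 0 <= x + y by rewrite addr_ge0// ltW.
have Ip := cutoff_interval_fin_num cutoff_pos (ltW x0) xy0.
have In := cutoff_interval_fin_num cutoff_neg (ltW x0) xy0.
by rewrite -(fineK Ip) -(fineK In) -!EFinB -!EFinM mulrBr.
Qed.

Lemma flux_increment_integrable : (mu \x mu)%E.-integrable setT (EFin \o D).
Proof.
apply: (eq_integrable _ _ _ _ (integrableB measurableT
  (cutoff_flux_integrable cutoff_pos) (cutoff_flux_integrable cutoff_neg))) =>
    //.
by move=> w _; rewrite /= DE.
Qed.

Let massE (x : R) : (`]0, +oo[%classic : set R) x ->
  (x * phi x * (f x - f 0 + rho * x * f' x))%:E =
  ((x * phi x)%:E * (\int[mu]_(z in `]0%R, x[) (f'^\+ z)%:E + (rho * x * f'^\+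
    x)%:E)
 - (x * phi x)%:E * (\int[mu]_(z in `]0%R, x[) (f'^\- z)%:E + (rho * x * f'^\-
   x)%:E))%E.
Proof.
rewrite /= in_itv/= andbT => x0.
have Ip := cutoff_interval_fin_num cutoff_pos (lexx 0) (ltW x0).
have In := cutoff_interval_fin_num cutoff_neg (lexx 0) (ltW x0).
have := integral_derivative (lexx 0) x0.
rewrite -(fineK Ip) -(fineK In) -!EFinB => -[<-].
congr EFin.
have -> : f' x = f'^\+ x - f'^\- x by rewrite -[in LHS](funrposBneg f').
by ring.
Qed.

Lemma mass_increment_integrable : mu.-integrable `]0, +oo[
  (fun x => (x * phi x * (f x - f 0 + rho * x * f' x))%:E).
Proof.
have mpos : measurable (`]0, +oo[%classic : set M) by exact: measurable_itv.
have := integrableB mpos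
  (cutoff_mass_integrable cutoff_pos) (cutoff_mass_integrable cutoff_neg).
by apply: eq_integrable => // x /[!inE] x0; rewrite massE.
Qed.

Lemma flux_increment_integral :
  (\int[mu \x mu]_w (D w)%:E = \int[mu]_(x in `]0%R, +oo[)
    (x * phi x * (f x - f 0 + rho * x * f' x))%:E)%E.
Proof.
under eq_integral do rewrite DE.
rewrite integralB//; [|exact: cutoff_flux_integrable|exact:
  cutoff_flux_integrable].
rewrite (cutoff_flux_integral cutoff_pos) (cutoff_flux_integral cutoff_neg).
rewrite -integralB//; [|exact: cutoff_mass_integrable|exact:
  cutoff_mass_integrable].
by apply: eq_integral => x /[!inE] x0; rewrite massE.
Qed.

(** The increments only involve f - f(0); adding f(0) back costs f(0) times the unit mass, which is
    the source term at the origin. *)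
Lemma mass_test_integral :
  \int[mu]_(x in `]0, +oo[) (x * phi x * (f x + rho * x * f' x)) =
  f 0 + fine (\int[mu \x mu]_w (D w)%:E)%E.
Proof.
have mI : mu.-integrable `]0, +oo[ (fun x : M => (x * phi x)%:E).
  apply/integrableP; split.
    by apply/measurable_EFinP; exact: measurable_mass hphi.
  rewrite (eq_integral (fun x : M => (x * phi x)%:E)); last first.
    by move=> x /[!inE] x0; rewrite gee0_abs// lee_fin (mass_integrand_ge0
      hphi).
  by rewrite (profile_mass hphi) ltry.
rewrite flux_increment_integral.
transitivity (\int[mu]_(x in `]0, +oo[) (f 0 * (x * phi x) +
    x * phi x * (f x - f 0 + rho * x * f' x))).
  by apply: eq_Rintegral => x _; ring.
rewrite RintegralD//; last 2 first.
- by have := integrableZl (measurable_itv _ : measurable (`]0, +oo[%classic :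
  set M)) (f 0) mI.
- exact: mass_increment_integrable.
by rewrite RintegralZl// /Rintegral (profile_mass hphi)/= mulr1.
Qed.

(** The symmetrization of [D]. Its integral is twice that of [D], whence the factor 1/2, and by
    symmetry of [K] it is the collision integrand: x (f(x + y) - f(x)) + y (f(x + y) - f(y)) = (x +
    y) f(x + y) - x f(x) - y f(y). *)
Let S (w : M * M) : R := D w + D (w.2, w.1).

Let swap_integrable : (mu \x mu)%E.-integrable setT (fun w : M * M => (D (w.2,
  w.1))%:E).
Proof.
have mD := measurable_int _ flux_increment_integrable.
have mDs : measurable_fun setT (fun w : M * M => (D (w.2, w.1))%:E).
  have ms := measurable_fun_pair (@measurable_snd _ _ M M) measurable_fst.
  exact: (measurableT_comp mD ms).
have [H _] := integrable21ltyP mu mu mD.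
have [_ H'] := integrable12ltyP mu mu mDs.
by apply: H'; apply: (le_lt_trans _ (H flux_increment_integrable)).
Qed.

Let swap_integral :
  (\int[mu \x mu]_w (D (w.2, w.1))%:E = \int[mu \x mu]_w (D w)%:E)%E.
Proof.
rewrite -(integral12_prod_meas1 swap_integrable).
by rewrite -(integral21_prod_meas1 flux_increment_integrable).
Qed.

Let S_integrable : (mu \x mu)%E.-integrable setT (EFin \o S).
Proof.
apply: (eq_integrable _ _ _ _ (integrableD measurableT
  flux_increment_integrable swap_integrable)) => //.
Qed.

Lemma stationary_weak_identity :
  \int[mu]_(x in `]0, +oo[) (x * phi x * (f x + rho * x * f' x)) =
  f 0 + 2^-1 * \int[mu]_(y in `]0, +oo[) (phi y *
    \int[mu]_(x in `]0, +oo[) (phi x *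
      (K y x * ((x + y) * f (x + y) - x * f x - y * f y)))).
Proof.
rewrite mass_test_integral; congr (_ + _).
(* The inner integral as an extended real; it is finite only for almost every [y], while the
   real-valued integrals of the statement apply [fine] to it. *)
pose G y := (\int[mu]_x (S (x, y))%:E)%E.
have mf : measurable_fun [set: M] f by exact: continuous_measurable_fun.
transitivity (2^-1 * fine (\int[mu]_y (fine (G y))%:E)%E); last first.
  congr (_ * _); rewrite [RHS]Rintegral_mkcond; apply: eq_Rintegral => y _.
  rewrite patchE; case: ifPn => [/[!inE] y0|]; last first.
    rewrite notin_setE/= in_itv/= andbT => /negP y0.
    rewrite /G integral0_eq// => x _; congr EFin.
    by rewrite /S /D/= /flux_density (negbTE y0) andbF !mul0r addr0.
  have y0' : 0 < y by move: y0; rewrite /= in_itv/= andbT.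
  rewrite -measurable_RintegralZl ?(profile_ge0 hphi)//; last first.
    apply: measurable_funM; first exact: measurable_profile hphi.
    exact: (measurable_collision_section Kcont Khom mf y0').
  rewrite [RHS]Rintegral_mkcond; congr fine; apply: eq_integral => x _.
  rewrite patchE; case: ifPn => [/[!inE]/= /[!in_itv]/= /[!andbT] x0|];
    last first.
    rewrite notin_setE/= in_itv/= andbT => /negP x0.
    by rewrite /S /D/= /flux_density (negbTE x0) andbF !mul0r addr0.
  congr EFin; rewrite /S /D/= /flux_density x0 y0'/= (Ksym x0 y0') (addrC y x).
  by ring.
have iG : mu.-integrable setT G.
  have := integrable_fubini_F S_integrable; apply: eq_integrable => // y _.
  by rewrite /fubini_F /G; apply: eq_integral => x _; rewrite /= /S addrC.
have -> : (\int[mu]_y (fine (G y))%:E = \int[mu]_y G y)%E.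
  apply: ae_eq_integral => //.
  - apply/measurable_EFinP; apply: measurableT_comp => //.
    exact: measurable_int _ iG.
  - exact: measurable_int _ iG.
  have aeF := ae_filter_ringOfSetsType mu.
  apply: (@filterS _ _ aeF _ _ _ (integrable_ae measurableT iG)) => y + _.
  by move=> /(_ I) Gy; rewrite fineK.
rewrite (integral21_prod_meas1 S_integrable) /=.
under [in RHS]eq_integral do rewrite /S EFinD.
rewrite integralD//=; last exact: flux_increment_integrable.
rewrite swap_integral.
have fD := integrable_fin_num measurableT flux_increment_integrable.
by rewrite [in RHS]fineD// -mulr2n -[X in _ * X]mulr_natl mulKf.
Qed.

End stationary_weak_identity.

(** * The self-similar flow *)

Section flow_integral.
Context (R : realType) (gamma : R) (K : R -> R -> R) (phi : R -> R).
Local Notation mu := (@lebesgue_measure R).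
Local Notation M := (measurableTypeR R).
Hypothesis hgamma : gamma < 1.
Hypothesis hphi : self_similar_profile gamma K phi.
Local Notation rho := (2 / (1 - gamma)).
Local Notation F := (self_similar_flow hphi).

Let g1 : 1 - gamma != 0. Proof. by rewrite gt_eqF// subr_gt0. Qed.

(** The substitution x = t^rho y has Jacobian t^rho, and rho - (gamma + 3) / (1 - gamma) = 1 -
    rho. *)
Lemma flow_integral (t : R) (f : R -> R) : 0 < t ->
  measurable_fun (`]0, +oo[%classic : set M) f ->
  (\int[F t]_(x in `]0%R, +oo[) (f x)%:E = (t `^ (1 - rho))%:E *
   \int[mu]_(y in `]0%R, +oo[) (phi y * f (t `^ rho * y))%:E)%E.
Proof.
move=> t0 mf; have c0 : 0 < t `^ rho by rewrite powR_gt0.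
have mfc : measurable_fun (`]0, +oo[%classic : set M) (fun y => f (t `^ rho *
  y)).
  apply: (measurable_comp (F := (`]0, +oo[%classic : set M)) (f := f)
    (g := fun y : M => t `^ rho * y : M)) => //.
  - by move=> _ [x /= + <-]; rewrite !in_itv/= !andbT => x0; exact: mulr_gt0.
  - exact: measurable_funM.
rewrite integral_density_measure// (integral_dilation c0); last first.
  apply: measurable_funM => //; apply: measurable_funTS.
  exact: (measurable_scaled_profile t hphi).
rewrite (eq_integral (fun y : M => (t `^ (- ((gamma + 3) / (1 - gamma))) *
    (phi y * f (t `^ rho * y)))%:E)); last first.
  move=> y /[!inE]/= /[!in_itv]/= /[!andbT] y0; congr EFin.
  have -> : scaled_profile gamma phi t (t `^ rho * y) =
      t `^ (- ((gamma + 3) / (1 - gamma))) * phi y.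
    rewrite /scaled_profile t0 mulr_gt0//=; congr (_ * phi _).
    by rewrite powRN mulrAC mulfV ?(gt_eqF c0)// mul1r.
  by ring.
rewrite measurable_integralZl ?powR_ge0//; last first.
  by apply: measurable_funM => //; exact: measurable_profile hphi.
rewrite muleA -EFinM -powRD ?(gt_eqF t0) ?implybT//.
by congr ((_ `^ _)%:E * _)%E; field.
Qed.

Lemma flow_Rintegral (t : R) (f : R -> R) : 0 < t ->
  measurable_fun (`]0, +oo[%classic : set M) f ->
  \int[F t]_(x in `]0, +oo[) f x = t `^ (1 - rho) *
   \int[mu]_(y in `]0, +oo[) (phi y * f (t `^ rho * y)).
Proof. by move=> t0 mf; rewrite /Rintegral flow_integral// fine_mulfin. Qed.

Lemma flow0 (t : R) : t <= 0 -> forall A, F t A = 0%E.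
Proof.
move=> t0 A; rewrite /self_similar_flow/= /density_measure integral0_eq// => x
  _.
by rewrite /scaled_profile ltNge t0.
Qed.

Lemma flow0_integral (t : R) (D : set M) (f : M -> \bar R) : t <= 0 ->
  (\int[F t]_(x in D) f x = 0)%E.
Proof.
move=> t0; rewrite (eq_measure_integral mzero).
  by rewrite integral_measure_zero.
by move=> A mA AD; rewrite flow0.
Qed.

Lemma flow0_Rintegral (t : R) (D : set M) (f : M -> R) : t <= 0 ->
  \int[F t]_(x in D) f x = 0.
Proof. by move=> t0; rewrite /Rintegral flow0_integral. Qed.

Lemma flow_nonpos (t : R) : F t [set x | x <= 0] = 0%E.
Proof.
rewrite /self_similar_flow/= /density_measure; apply: integral0_eq => x /= x0.
by rewrite /scaled_profile (ltNge 0 x) x0 andbF.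
Qed.

Lemma flow_moment (t a : R) : 0 < t ->
  (\int[F t]_(x in `]0%R, +oo[) (x `^ a)%:E = (t `^ (1 + (a - 1) * rho))%:E *
   \int[mu]_(y in `]0%R, +oo[) (y `^ a * phi y)%:E)%E.
Proof.
move=> t0; rewrite flow_integral//; last first.
  by apply: measurable_funTS; exact: measurable_powR.
rewrite (eq_integral (fun y : M => ((t `^ rho) `^ a * (y `^ a * phi y))%:E));
  last first.
  move=> y /[!inE]/= /[!in_itv]/= /[!andbT] y0.
  by rewrite powRM ?powR_ge0 ?(ltW y0)// mulrC mulrA.
rewrite measurable_integralZl ?powR_ge0//; last exact: measurable_moment hphi _.
rewrite muleA -EFinM -powRrM -powRD ?(gt_eqF t0) ?implybT//.
by congr ((_ `^ _)%:E * _)%E; ring.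
Qed.

(** For the moment of order 1 the power of t is t itself: mass enters at unit rate. *)
Lemma flow_mass (t : R) : 0 < t ->
  (\int[F t]_(x in `]0%R, +oo[) x%:E = t%:E)%E.
Proof.
move=> t0; rewrite (eq_integral (fun x : M => (x `^ 1)%:E)); last first.
  by move=> x /[!inE]/= /[!in_itv]/= /[!andbT] /ltW x0; rewrite powRr1.
rewrite flow_moment// subrr mul0r addr0 powRr1 ?(ltW t0)//.
rewrite (eq_integral (fun x : M => (x * phi x)%:E)); last first.
  by move=> x /[!inE]/= /[!in_itv]/= /[!andbT] /ltW x0; rewrite powRr1.
by rewrite (profile_mass hphi) mule1.
Qed.

End flow_integral.

(** * Continuity and differentiation along the flow *)

Section one_variable.
Context (R : realType).
Implicit Types (g : R -> R) (T s t : R).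

(** Reflection at 0 replaces one-sided continuity on the half-line by continuity on the line. *)
Lemma within_continuous_norm g : {within `[0, +oo[, continuous g} ->
  continuous (fun x : R => g `|x|).
Proof.
move=> /subspace_continuousP cg x.
have nx0 : (`[0, +oo[%classic : set R) `|x| by rewrite /= in_itv/= andbT.
apply/cvgrPdist_le => e e0.
have := cg _ nx0; move=> /cvgrPdist_le/(_ e e0).
rewrite near_withinE => H.
have cn : {for x, continuous (fun y : R => `|y|)} by exact: norm_continuous.
apply: (@filterS _ (nbhs x) _ _ _ _ (cn _ H)) => y /=; apply.
by rewrite in_itv/= andbT.
Qed.

Lemma continuous_norm_powR (r : R) : 0 < r -> continuous (fun x : R => `|x| `^
  r).
Proof.
move=> r0; apply: (@within_continuous_norm (fun x => x `^ r)).
apply/subspace_continuousP => x;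
  rewrite /from_subspace /= in_itv/= andbT le_eqVlt.
move=> /predU1P[<-|x0].
  apply/cvgrPdist_le => e e0; rewrite near_withinE.
  near=> y; rewrite /= in_itv/= andbT => y0.
  rewrite powR0 ?gt_eqF// sub0r normrN ger0_norm ?powR_ge0//.
  (* The radius e^(1/r) makes y^r at most e. *)
  have -> : e = (e `^ r^-1) `^ r by rewrite -powRrM mulVf ?gt_eqF// powRr1//
    ltW.
  rewrite ge0_ler_powR ?nnegrE ?powR_ge0 ?(ltW r0)//.
  near: y; exists (e `^ r^-1); first by rewrite /= powR_gt0.
  move=> y/=; rewrite sub0r normrN => /ltW; apply: le_trans; exact: ler_norm.
apply: cvg_within_filter.
have cx : {for x, continuous (fun y : R => y `^ r)}; last exact: cx.
apply: differentiable_continuous; apply/derivable1_diffP.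
by apply: derivable_powR; rewrite in_itv/= andbT.
Unshelve. all: end_near. Qed.

Lemma is_derive_quotient (f : R -> R) (x l : R) :
  (fun y => (f y - f x) / (y - x)) @ x^' --> l -> is_derive x 1 f l.
Proof.
move=> H; suff H' : (fun h => h^-1 *: (f (h *: 1 + x) - f x)) @ 0^' --> l.
  by apply: DeriveDef; [apply/cvg_ex; exists l|exact: cvg_lim H'].
apply/cvgrPdist_le => e e0; have /cvgrPdist_le/(_ e e0) := H.
rewrite !near_withinE => -[d d0 Hd]; exists d => // h hd h0.
rewrite scaler1; have := Hd (h + x).
rewrite /= opprD addrCA subrr addr0 addrK => /(_ _ _) H2.
rewrite mulrC in H2; apply: H2.
  by move: hd; rewrite /= sub0r.
by apply: contra_neq h0 => /(congr1 (fun y => y - x)); rewrite addrK subrr.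
Qed.

(** Near a positive point the half-line is a full neighbourhood and reflection is the identity. *)
Lemma has_derive_in_is_derive (f : R -> R) (x l : R) : 0 < x ->
  has_derive_in `[0, +oo[ f x l -> is_derive x 1 (fun y : R => f `|y|) l.
Proof.
move=> x0 H; apply: is_derive_quotient.
apply/cvgrPdist_le => e e0; have /cvgrPdist_le/(_ e e0) := H.
rewrite !near_withinE => H2; near=> y => yx.
have y0 : 0 <= y by rewrite ltW//; near: y; exact: lt_nbhsr.
rewrite (ger0_norm y0) (gtr0_norm x0).
have : y != x -> (`[0, +oo[%classic : set R) y -> `|l - (f y - f x) / (y - x)|
  <= e.
  by near: y; exact: H2.
by apply => //; rewrite /= in_itv/= andbT.
Unshelve. all: end_near. Qed.

End one_variable.

(** * Extension in time and uniformly regular families *)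

Section clamp.
Context (R : realType).

(** For T >= 0, the nearest-point projection onto [0, T]. *)
Definition clamp (T s : R) : R := Num.max 0 (Num.min s T).

Lemma clamp_itv T s : 0 <= T -> 0 <= clamp T s <= T.
Proof.
by move=> T0; rewrite /clamp le_max lexx/= ge_max T0 ge_min lexx orbT.
Qed.

Lemma clamp_id T s : 0 <= s <= T -> clamp T s = s.
Proof.
by move=> /andP[s0 sT]; rewrite /clamp (min_idPl sT) (max_idPr s0).
Qed.

Lemma clamp_lipschitz T s r : 0 <= T -> `|clamp T s - clamp T r| <= `|s - r|.
Proof.
move=> T0; wlog rs : s r / r <= s.
  move=> H; have [/H//|/ltW/H] := leP r s.
  by rewrite distrC (distrC s).
rewrite (ger0_norm (x := s - r)) ?subr_ge0//.
rewrite ler_norml /clamp.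
case: (leP s T) => h1; case: (leP r T) => h2; [case: (leP 0 s) => h3;
  case: (leP 0 r) => h4|case: (leP 0 s) => h3; case: (leP 0 T) => h4|
  case: (leP 0 r) => h3; case: (leP 0 T) => h4|case: (leP 0 T) => h4];
  apply/andP; split; lra.
Qed.

Lemma continuous_clamp T : 0 <= T -> continuous (clamp T).
Proof.
move=> T0 s; apply/cvgrPdist_le => e e0; near=> r.
apply: le_trans (clamp_lipschitz _ _ T0) _; near: r.
by exists e => // r /= /ltW.
Unshelve. all: end_near. Qed.

Lemma near_clamp T s (P : R -> Prop) : 0 <= T ->
  (\forall r \near within `[0, T] (nbhs (clamp T s)), P r) ->
  \forall r \near s, P (clamp T r).
Proof.
move=> T0; rewrite near_withinE => H.
have cc := @continuous_clamp T T0 s.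
apply: (@filterS _ (nbhs s) _ _ _ _ (cc _ H)) => r /=; apply.
by rewrite in_itv/= clamp_itv.
Qed.

End clamp.

(* A family with these properties can be evaluated and integrated along
   continuous reparametrizations. *)
Definition tame_family (R : realType) (V : R -> R -> R) :=
  [/\ exists B, forall s x, `|V s x| <= B,
      forall s, continuous (V s) &
      forall s e, 0 < e -> \forall r \near s, forall x, `|V r x - V s x| <= e].

Section tame_family.
Context (R : realType).
Implicit Types (V W : R -> R -> R).
Local Notation mu := (@lebesgue_measure R).
Local Notation M := (measurableTypeR R).

(** Convergence uniform in space allows time and evaluation point to move together: V(r, c(r)) is
    compared with V(s, c(r)), then with V(s, c(s)). *)
Lemma tame_eval V (c : R -> R) : tame_family V -> continuous c ->
  continuous (fun s => V s (c s)).
Proof.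
move=> [_ cV uV] cc s; apply/cvgrPdist_le => e e0.
have e20 : 0 < e / 2 by rewrite divr_gt0.
have c1 : (fun r => V s (c r)) @ s --> V s (c s).
  exact: (@continuous_comp _ _ _ c (V s) s (cc s) (cV s (c s))).
move/cvgrPdist_le : c1 => /(_ _ e20) H1.
have H2 := uV s _ e20.
near=> r.
rewrite (splitr e) -(subrKA (V s (c r))) (le_trans (ler_normD _ _))// lerD//.
  by near: r; exact: H1.
rewrite distrC; have : forall x, `|V r x - V s x| <= e / 2 by near: r;
  exact: H2.
exact.
Unshelve. all: end_near. Qed.

Lemma tameD V W : tame_family V -> tame_family W ->
  tame_family (fun s x => V s x + W s x).
Proof.
move=> [[B HB] cV uV] [[B' HB'] cW uW]; split.
- exists (B + B') => s x; apply: (le_trans (ler_normD _ _)); exact: lerD.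
- by move=> s x; apply: cvgD; [exact: cV|exact: cW].
- move=> s e e0; have e20 : 0 < e / 2 by rewrite divr_gt0.
  have H1 := uV s _ e20; have H2 := uW s _ e20.
  near=> r => x; rewrite opprD addrACA (splitr e).
  rewrite (le_trans (ler_normD _ _))// lerD//.
    have : forall x, `|V r x - V s x| <= e / 2 by near: r; exact: H1.
    exact.
  have : forall x, `|W r x - W s x| <= e / 2 by near: r; exact: H2.
  exact.
Unshelve. all: end_near. Qed.

Lemma tameZ V (k : R) : tame_family V -> tame_family (fun s x => k * V s x).
Proof.
move=> [[B HB] cV uV]; split.
- by exists (`|k| * B) => s x; rewrite normrM ler_wpM2l.
- by move=> s x; apply: cvgM; [exact: cvg_cst|exact: cV].
- move=> s e e0; have ek0 : 0 < e / (`|k| + 1) by rewrite divr_gt0// ltr_wpDl.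
  have H1 := uV s _ ek0; near=> r => x.
  rewrite -mulrBr normrM; apply: (@le_trans _ _ ((`|k| + 1) * (e / (`|k| +
    1)))).
    apply: ler_pM => //; first by rewrite lerDl.
    have : forall x, `|V r x - V s x| <= e / (`|k| + 1) by near: r; exact: H1.
    exact.
  by rewrite mulrCA mulfV ?mulr1// gt_eqF// ltr_wpDl.
Unshelve. all: end_near. Qed.

Section tame_integral.
Variables (V : R -> R -> R) (c : R -> R) (m : R -> R).
Hypothesis tV : tame_family V.
Hypothesis cc : continuous c.
Hypothesis m_int : mu.-integrable `]0, +oo[ (EFin \o m).
Hypothesis m_ge0 : forall y : R, 0 < y -> 0 <= m y.

Let mpos : measurable (`]0, +oo[%classic : set M).
Proof. exact: measurable_itv. Qed.

Let mm : measurable_fun (`]0, +oo[%classic : set M) m.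
Proof. by move: m_int => /integrableP[/measurable_EFinP]. Qed.

Lemma measurable_tame (s : R) :
  measurable_fun (`]0, +oo[%classic : set M) (fun y => m y * V s (c s * y)).
Proof.
apply: measurable_funM => //; apply: measurable_funTS.
apply: (measurableT_comp (f := V s)).
  by apply: continuous_measurable_fun; case: tV.
exact: measurable_funM.
Qed.

Lemma tame_dominated : exists2 B : R, 0 <= B & forall s y : R, 0 < y ->
  `|m y * V s (c s * y)| <= B * m y.
Proof.
have [[B HB] _ _] := tV; exists B => [|s y y0].
  exact: le_trans (HB 0 0).
by rewrite normrM mulrC (ger0_norm (m_ge0 y0)) ler_wpM2r// m_ge0.
Qed.

Lemma integrable_tame (s : R) :
  mu.-integrable `]0, +oo[ (fun y => (m y * V s (c s * y))%:E).
Proof.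
have [B B0 HB] := tame_dominated.
apply: (@le_integrable _ _ _ mu _ mpos _ (fun y => B%:E * (m y)%:E)%E).
- by apply/measurable_EFinP; exact: measurable_tame.
- move=> y /=; rewrite in_itv/= andbT => y0; rewrite lee_fin.
  by rewrite (le_trans (HB s y y0))// ler_norm.
- exact: (integrableZl mpos B m_int).
Qed.

(** Dominated convergence: the bound of [V] times the integrable [m] dominates at all times. *)
Lemma continuous_tame_integral :
  continuous (fun s => \int[mu]_(y in `]0, +oo[) (m y * V s (c s * y))).
Proof.
move=> s; have [B B0 HB] := tame_dominated.
have := @continuity_under_integral R _ M mu
  (fun s y => m y * V s (c s * y)) _ mpos
  (s - 1) (s + 1) (fun s _ => integrable_tame s) _ (fun y => B * m y) _ _ s.
apply.
- apply/aeW => y /=; rewrite in_itv/= andbT => y0 r _.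
  apply: cvgM; first exact: cvg_cst.
  apply: (@tame_eval V (fun r => c r * y)) => // z.
  by apply: cvgM; [exact: cc|exact: cvg_cst].
- exact: (integrableZl mpos B m_int).
- by move=> r _; apply/aeW => y /=; rewrite in_itv/= andbT => y0; exact: HB.
- by rewrite inE/= in_itv/= ltrBlDr ltrDl ltr01.
Qed.

End tame_integral.
End tame_family.

Lemma supported_bounded (R : realType) (g : R -> R) (N : R) : 0 < N ->
  {within `[0, +oo[, continuous g} -> (forall x, N < x -> g x = 0) ->
  exists B, forall x, 0 <= x -> `|g x| <= B.
Proof.
move=> N0 cg g_supp; have cn : {within `[0, N], continuous (fun x : R => `|g
  `|x| |)}.
  apply: continuous_subspaceT => x; apply: continuous_comp;
    last exact: norm_continuous.
  exact: within_continuous_norm cg x.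
have [c cN Hc] := EVT_max (ltW N0) cn.
exists `|g `|c| | => x x0; have [xN|Nx] := leP x N.
  by have := Hc x; rewrite (ger0_norm x0); apply; rewrite in_itv/= x0.
by rewrite g_supp// normr0.
Qed.

Section extension.
Context (R : realType) (T : R).
Hypothesis T0 : 0 < T.
Implicit Types (u v : R -> R -> R).

(* Clamping the time and reflecting the space variable turns the conditions on
   [0, T] x [0, +oo[ into conditions on the whole plane. *)
Definition extend v : R -> R -> R := fun s x => v (clamp T s) `|x|.

(** A bound B at one time gives the bound 1 + B at nearby times; compactness of [0, T] makes it
    uniform. *)
Lemma tame_extend v (N : R) : 0 < N ->
  (forall t, 0 <= t <= T -> {within `[0, +oo[, continuous (v t)}) ->
  (forall t x, 0 <= t <= T -> N < x -> v t x = 0) ->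
  (forall t e, 0 <= t <= T -> 0 < e -> \forall s \near within `[0, T] (nbhs t),
     forall x, 0 <= x -> `|v s x - v t x| <= e) ->
  tame_family (extend v).
Proof.
move=> N0 cv v_supp uv.
have bnd t : 0 <= t <= T -> exists B, forall x, 0 <= x -> `|v t x| <= B.
  move=> tT; apply: (supported_bounded N0 (cv t tT)) => x Nx; exact: v_supp.
split.
- have : compact (`[0, T]%classic : set R) by exact: segment_compact.
  rewrite compact_near_coveringP => /near_covering_withinP cov.
  have := cov _ (@pinfty_nbhs R)
    (fun B t => forall x, 0 <= x -> `|v t x| <= B) _.
  case.
    move=> t; rewrite /= in_itv/= => tT; have [B HB] := bnd t tT.
    have := uv t 1 tT ltr01; rewrite near_withinE => H1.
    near=> t' C; rewrite /= in_itv/= => t'T x x0.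
    rewrite -(subrK (v t x) (v t' x)) (le_trans (ler_normD _ _))//.
    apply: (@le_trans _ _ (1 + B)); last by near: C; apply: nbhs_pinfty_ge;
      exact: num_real.
    apply: lerD; last exact: HB.
    have : (`[0, T]%classic : set R) t' -> forall x, 0 <= x -> `|v t' x - v t
      x| <= 1.
      by near: t'.
    by apply => //; rewrite /= in_itv.
  move=> B [Breal HB]; exists (B + 1) => s x.
  apply: (HB (B + 1)); rewrite ?ltrDl//=.
  by rewrite in_itv/= clamp_itv// ltW.
- by move=> s x; exact: within_continuous_norm (cv _ (clamp_itv _ (ltW T0))) x.
- move=> s e e0; rewrite /extend.
  have H := uv _ _ (clamp_itv s (ltW T0)) e0.
  have := near_clamp (ltW T0) H; apply: filterS => r Hr x.
  exact: Hr.
Unshelve. all: end_near. Qed.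

End extension.

(** Turns closeness of a difference quotient to its limit into a Lipschitz estimate. *)
Lemma quotient_bound (R : realFieldType) (a b c B : R) : b != 0 ->
  `|a / b - c| <= 1 -> `|c| <= B -> `|a| <= (B + 1) * `|b|.
Proof.
move=> b0 abc cB; have -> : a = (a / b - c + c) * b by rewrite subrK divfK.
rewrite normrM ler_wpM2r// (le_trans (ler_normD _ _))//.
by rewrite addrC lerD.
Qed.

Lemma has_derive_in_within_continuous (R : realType) (A : set R) (f f' : R ->
  R) :
  (forall x, A x -> has_derive_in A f x (f' x)) -> {within A, continuous f}.
Proof.
move=> df; apply/subspace_continuousP => x Ax; rewrite /from_subspace.
apply/cvgrPdist_le => e e0; have /cvgrPdist_le/(_ 1 ltr01) := df x Ax.
rewrite !near_withinE => H.
have B0 : 0 < `|f' x| + 1 by rewrite ltr_wpDl.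
near=> y => Ay; have [->|yx] := eqVneq y x; first by rewrite subrr normr0 ltW.
rewrite distrC; apply: (@le_trans _ _ ((`|f' x| + 1) * `|y - x|)).
  apply: (@quotient_bound _ _ _ (f' x)) => //; first by rewrite subr_eq0.
  rewrite distrC; have : y != x -> A y -> `|f' x - (f y - f x) / (y - x)| <= 1.
    by near: y; exact: H.
  exact.
rewrite mulrC -ler_pdivlMr// distrC; near: y.
by exists (e / (`|f' x| + 1)); [rewrite /= divr_gt0|move=> y /= /ltW].
Unshelve. all: end_near. Qed.

(** The unbounded factor |x| is at most N wherever [V] can be nonzero. *)
Lemma tame_norm_mul (R : realType) (V : R -> R -> R) (N : R) : 0 < N ->
  (forall s x, N < `|x| -> V s x = 0) -> tame_family V ->
  tame_family (fun s x => `|x| * V s x).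
Proof.
move=> N0 V0 [[B HB] cV uV]; split.
- exists (N * B) => s x; rewrite normrM normr_id.
  have [xN|Nx] := leP `|x| N; first exact: ler_pM.
  by rewrite V0// normr0 mulr0 mulr_ge0 ?(ltW N0)// (le_trans _ (HB 0 0)).
- by move=> s x; apply: cvgM; [exact: norm_continuous|exact: cV].
- move=> s e e0; have eN0 : 0 < e / N by rewrite divr_gt0.
  have H1 := uV s _ eN0; near=> r => x.
  rewrite -mulrBr normrM normr_id.
  have [xN|Nx] := leP `|x| N; last by rewrite !V0// subrr normr0 mulr0 ltW.
  apply: (@le_trans _ _ (N * (e / N))); last by rewrite mulrC divfK ?gt_eqF.
  apply: ler_pM => //.
  have : forall x, `|V r x - V s x| <= e / N by near: r; exact: H1.
  exact.
Unshelve. all: end_near. Qed.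

(** The properties of an extended test function used to differentiate along the flow: [UX] and [DU]
    stand for its space and time derivatives. The time derivative is asserted only inside ]0, T[,
    because clamping may create corners at 0 and [T]. *)
Record regular_test (R : realType) (T N : R) (U UX DU : R -> R -> R) : Prop :=
  RegularTest {
  test_tame : tame_family U;
  test_dx_tame : tame_family UX;
  test_xdx_tame : tame_family (fun s x => `|x| * UX s x);
  test_dt_tame : tame_family DU;
  test_dx : forall s x : R, 0 < x -> is_derive x 1 (U s) (UX s x);
  test_dx_supp : forall s x, N < `|x| -> UX s x = 0;
  test_dt : forall s e : R, 0 < s < T -> 0 < e -> \forall r \near s^',
    forall x, `|(U r x - U s x) / (r - s) - DU s x| <= e }.

Section C1_time_C1c_regular.
Context (R : realType) (T : R).
Hypothesis T0 : 0 < T.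

(** Differentiability in time, uniform in space and with bounded derivative, implies continuity in
    time uniform in space. *)
Lemma cvg_C1_quotient_uniform (t : R) (u : R -> R -> R) (w : R -> R) (B : R) :
  (forall x, 0 <= x -> `|w x| <= B) ->
  (forall e, 0 < e -> \forall s \near within `[0, T] t^',
    forall x, 0 <= x -> `|(u s x - u t x) / (s - t) - w x| <= e) ->
  forall e, 0 < e -> \forall s \near within `[0, T] (nbhs t),
    forall x, 0 <= x -> `|u s x - u t x| <= e.
Proof.
move=> wB H e e0; have := H 1 ltr01; rewrite !near_withinE => H1.
have B0 : 0 < B + 1 by rewrite ltr_wpDl// (le_trans _ (wB 0 (lexx 0))).
near=> s => sT x x0; have [->|st] := eqVneq s t.
  by rewrite subrr normr0 ltW.
apply: (@le_trans _ _ ((B + 1) * `|s - t|)).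
  apply: (@quotient_bound _ _ _ (w x)); [by rewrite subr_eq0| |exact: wB].
  have : s != t -> (`[0, T]%classic : set R) s ->
    forall x, 0 <= x -> `|(u s x - u t x) / (s - t) - w x| <= 1.
    by near: s; exact: H1.
  exact.
rewrite mulrC -ler_pdivlMr// distrC; near: s.
by exists (e / (B + 1)); [rewrite /= divr_gt0|move=> s /= /ltW].
Unshelve. all: end_near. Qed.

Lemma C1c_derive_supp (M : R) (f f' : R -> R) (x : R) : C1c M f f' ->
  0 < x -> M < x -> f' x = 0.
Proof.
move=> [df _ f_supp] x0 Mx; have [_ <-] := has_derive_in_is_derive x0 (df x
  (ltW x0)).
rewrite (@near_eq_derive _ _ _ _ (cst 0)) ?derive_cst//.
near=> y; have y0 : 0 <= y by rewrite ltW//; near: y; exact: lt_nbhsr.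
rewrite (ger0_norm y0) f_supp//; near: y; exact: lt_nbhsr.
Unshelve. all: end_near. Qed.

Lemma C1_time_C1c_regular (u du : R -> R -> R) : C1_time_C1c T u du ->
  exists N UX, 0 < N /\
    regular_test T N (extend T u) UX (extend T du).
Proof.
(* The maximum with 1 makes the support bound positive, as [tame_extend] requires. *)
move=> [M [ux [dux H]]]; pose N := Num.max M 1.
have N0 : 0 < N by rewrite lt_max ltr01 orbT.
have MN x : N < x -> M < x by rewrite gt_max => /andP[].
have xN0 x : N < x -> 0 < x by apply: lt_trans.
have cu t : 0 <= t <= T -> {within `[0, +oo[, continuous (u t)}.
  move=> /H[[df _ _] _ _ _]; apply: has_derive_in_within_continuous => x.
  by rewrite /= in_itv/= andbT; exact: df.
have cux t : 0 <= t <= T -> {within `[0, +oo[, continuous (ux t)}.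
  by move=> /H[[_ ? _] _ _ _].
have cdu t : 0 <= t <= T -> {within `[0, +oo[, continuous (du t)}.
  move=> /H[_ [df _ _] _ _]; apply: has_derive_in_within_continuous => x.
  by rewrite /= in_itv/= andbT; exact: df.
have cdux t : 0 <= t <= T -> {within `[0, +oo[, continuous (dux t)}.
  by move=> /H[_ [_ ? _] _ _].
have su t x : 0 <= t <= T -> N < x -> u t x = 0.
  by move=> /H[[_ _ f0] _ _ _] Nx; apply: f0; [exact: ltW (xN0 _ Nx)|exact: MN].
have sdu t x : 0 <= t <= T -> N < x -> du t x = 0.
  by move=> /H[_ [_ _ f0] _ _] Nx; apply: f0; [exact: ltW (xN0 _ Nx)|exact: MN].
have sux t x : 0 <= t <= T -> N < x -> ux t x = 0.
  by move=> /H[C _ _ _] Nx; apply: (C1c_derive_supp C); [exact: xN0|exact: MN].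
have sdux t x : 0 <= t <= T -> N < x -> dux t x = 0.
  by move=> /H[_ C _ _] Nx; apply: (C1c_derive_supp C); [exact: xN0|exact: MN].
have tU : tame_family (extend T u).
  apply: (tame_extend T0 N0) => // t e tT e0.
  have [B HB] := supported_bounded N0 (cdu t tT) (fun x => sdu t x tT).
  apply: (cvg_C1_quotient_uniform HB) e0 => e' e'0.
  have [_ _ H1 _] := H t tT; have := H1 e' e'0; apply: filterS => s Hs x x0.
  by apply: le_trans (Hs x x0); rewrite lerDl.
have tUX : tame_family (extend T ux).
  apply: (tame_extend T0 N0) => // t e tT e0.
  have [B HB] := supported_bounded N0 (cdux t tT) (fun x => sdux t x tT).
  apply: (cvg_C1_quotient_uniform HB) e0 => e' e'0.
  have [_ _ H1 _] := H t tT; have := H1 e' e'0; apply: filterS => s Hs x x0.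
  by apply: le_trans (Hs x x0); rewrite lerDr.
have tDU : tame_family (extend T du).
  apply: (tame_extend T0 N0) => // t e tT e0.
  have [_ _ _ H1] := H t tT; have := H1 e e0; apply: filterS => s Hs x x0.
  by apply: le_trans (Hs x x0); rewrite lerDl.
have sUX s x : N < `|x| -> extend T ux s x = 0.
  by move=> Nx; rewrite /extend sux// clamp_itv// ltW.
exists N, (extend T ux); split => //; split => //.
- exact: tame_norm_mul sUX _.
- move=> s x x0; rewrite /extend (gtr0_norm x0).
  have [[df _ _] _ _ _] := H _ (clamp_itv s (ltW T0)).
  exact: has_derive_in_is_derive x0 (df x (ltW x0)).
- move=> s e /andP[s0 sT] e0.
  have sT' : 0 <= s <= T by rewrite !ltW.
  have [_ _ H1 _] := H s sT'; have := H1 e e0; rewrite !near_withinE => {}H1.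
  near=> r => rs x.
  have rT : 0 <= r <= T.
    by rewrite !ltW//; near: r; [exact: lt_nbhsl|exact: lt_nbhsr].
  rewrite /extend (clamp_id rT) (clamp_id sT').
  have : r != s -> (`[0, T]%classic : set R) r -> forall x, 0 <= x ->
    `|(u r x - u s x) / (r - s) - du s x| +
    `|(ux r x - ux s x) / (r - s) - dux s x| <= e by near: r; exact: H1.
  move=> /(_ rs) Hr; apply: le_trans (Hr _ `|x| (normr_ge0 x)).
    by rewrite lerDl.
  by rewrite /= in_itv.
Unshelve. all: end_near. Qed.

End C1_time_C1c_regular.

Lemma is_derive_cvg_quotient (R : realType) (f : R -> R) (x l : R) :
  is_derive x 1 f l -> (fun y => (f y - f x) / (y - x)) @ x^' --> l.
Proof.
move=> [df <-]; have H : (fun h => h^-1 *: (f (h *: 1 + x) - f x)) @ 0^' -->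
  'D_1 f x.
  exact: df.
apply/cvgrPdist_le => e e0; have /cvgrPdist_le/(_ e e0) := H.
rewrite !near_withinE => -[d d0 Hd]; exists d => // y yd yx.
have := Hd (y - x); rewrite scaler1 subrK mulrC; apply;
  last by rewrite subr_eq0.
by move: yd; rewrite /= sub0r normrN distrC.
Qed.

(** * The time derivative of the tested flow *)

Section evolution.
Context (R : realType) (gamma : R) (K : R -> R -> R) (phi : R -> R) (T : R).
Local Notation mu := (@lebesgue_measure R).
Local Notation M := (measurableTypeR R).
Hypothesis hgamma : gamma < 1.
Hypothesis hphi : self_similar_profile gamma K phi.
Hypothesis T0 : 0 < T.
Local Notation rho := (2 / (1 - gamma)).

Variables (N : R) (U UX DU : R -> R -> R).
Hypothesis hU : regular_test T N U UX DU.

(** s^rho on [0, T], extended continuously to the line; the absolute value gives the form treated in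
    [continuous_norm_powR]. *)
Definition scale_factor (s : R) : R := `|clamp T s| `^ rho.
Local Notation c := scale_factor.
Local Notation m := (fun y => y * phi y).

Lemma continuous_scale_factor : continuous c.
Proof.
move=> s; apply: (@continuous_comp _ _ _ (clamp T) (fun x : R => `|x| `^ rho)).
  by apply: continuous_clamp; exact: ltW.
exact: continuous_norm_powR (rho_gt0 hgamma) _.
Qed.

Lemma scale_factorE s : 0 <= s <= T -> c s = s `^ rho.
Proof. by move=> sT; rewrite /c clamp_id// ger0_norm//; case/andP: sT. Qed.

Lemma integrable_mass : mu.-integrable `]0, +oo[ (EFin \o m).
Proof.
apply/integrableP; split; first by apply/measurable_EFinP;
  exact: measurable_mass hphi.
rewrite (eq_integral (fun x : M => (x * phi x)%:E)); last first.
  by move=> x /[!inE] x0; rewrite gee0_abs// lee_fin (mass_integrand_ge0 hphi).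
by rewrite (profile_mass hphi) ltry.
Qed.

Lemma mass_ge0 (y : R) : 0 < y -> 0 <= m y.
Proof. by move=> y0; rewrite mulr_ge0 ?(profile_ge0 hphi)// ltW. Qed.

(** For 0 < s <= T, [s] times this is the integral of x V(s, x) against F(s). *)
Definition evol_value (V : R -> R -> R) (s : R) : R :=
  \int[mu]_(y in `]0, +oo[) (m y * V s (c s * y)).

Lemma continuous_evol V : tame_family V -> continuous (evol_value V).
Proof.
move=> tV; apply: continuous_tame_integral => //.
- exact: continuous_scale_factor.
- exact: integrable_mass.
- exact: mass_ge0.
Qed.

(** At x = s^rho y, the part of the derivative of s U(s, s^rho y) that does not come from the
    explicit time argument of [U]. *)
Let HV (s x : R) := U s x + rho * (`|x| * UX s x).

Lemma tame_HV : tame_family HV.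
Proof.
by apply: tameD (test_tame hU) _; apply: tameZ; exact: test_xdx_tame hU.
Qed.

Lemma is_derive_scale_factor (s : R) : 0 < s < T ->
  is_derive s 1 c (rho * s `^ (rho - 1)).
Proof.
move=> /andP[s0 sT]; apply: is_derive_quotient.
have := is_derive_cvg_quotient (is_derive1_powR rho s0).
apply: cvg_trans; apply: near_eq_cvg; rewrite near_withinE.
near=> r => _; rewrite !scale_factorE ?(ltW s0) ?(ltW sT)//.
by rewrite !ltW//; near: r; [exact: lt_nbhsl|exact: lt_nbhsr].
Unshelve. all: end_near. Qed.

(** The chain rule without joint differentiability: the increment is split into one in time at the
    moving point c(r) y and one in space at the fixed time [s]. *)
Lemma is_derive_evaluation (s y : R) : 0 < s < T -> 0 < y ->
  is_derive s 1 (fun r => U r (c r * y))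
    (DU s (c s * y) + UX s (c s * y) * (rho * s `^ (rho - 1) * y)).
Proof.
move=> sT y0; have := sT => /andP[s0 sT1].
have cs0 : 0 < c s * y.
  by rewrite mulr_gt0// scale_factorE ?powR_gt0// !ltW.
apply: is_derive_quotient.
have D2 : is_derive s 1 (fun r => U s (c r * y))
    (UX s (c s * y) * (rho * s `^ (rho - 1) * y)).
  have d1 : is_derive s 1 (fun r => c r * y) (rho * s `^ (rho - 1) * y).
    have dc := is_derive_scale_factor sT.
    apply: (@is_derive_eq _ _ _ (fun r => c r * y) s 1 _ _
      (is_deriveM dc (is_derive_cst y s 1))).
    by rewrite scaler0 add0r [RHS]mulrC.
  have d2 : is_derive (c s * y) 1 (U s) (UX s (c s * y)) := test_dx hU s cs0.
  exact: (@is_derive1_comp _ (U s) (fun r => c r * y) s _ _ d2 d1).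
have Q2 := is_derive_cvg_quotient D2.
(* The time quotient is uniformly close to [DU s], which is continuous along the moving point. *)
have Q1 : (fun r => (U r (c r * y) - U s (c r * y)) / (r - s)) @ s^' --> DU s
  (c s * y).
  apply/cvgrPdist_le => e e0.
  have e20 : 0 < e / 2 by rewrite divr_gt0.
  have H1 := test_dt hU sT e20.
  have ccy : continuous (fun r => c r * y).
    by move=> r; apply: cvgM; [exact: continuous_scale_factor|exact: cvg_cst].
  have [_ cDU _] := test_dt_tame hU.
  have H2 : (fun r => DU s (c r * y)) @ s --> DU s (c s * y).
    exact: (@continuous_comp _ _ _ (fun r => c r * y) (DU s) s (ccy s) (cDU s
      _)).
  move/cvgrPdist_le : H2 => /(_ _ e20) H2.
  have H2' : \forall r \near s^', `|DU s (c s * y) - DU s (c r * y)| <= e / 2.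
    by rewrite near_withinE; apply: filterS H2.
  near=> r.
  rewrite (splitr e) -(subrKA (DU s (c r * y))) (le_trans (ler_normD _ _))//
    lerD//.
    by near: r; exact: H2'.
  rewrite distrC.
  have : forall x, `|(U r x - U s x) / (r - s) - DU s x| <= e / 2 by near: r;
    exact: H1.
  exact.
apply: cvg_trans (cvgD Q1 Q2); apply: near_eq_cvg; near=> r.
by rewrite /= -mulrDl subrKA.
Unshelve. all: end_near. Qed.

(** Differentiation under the integral sign, with a multiple of the mass density as dominating
    function. *)
Lemma is_derive_evolution (s : R) : 0 < s < T ->
  is_derive s 1 (fun r => clamp T r * evol_value U r)
    (s * evol_value DU s + evol_value HV s).
Proof.
move=> sT.
have mpos : measurable (`]0, +oo[%classic : set M) by exact: measurable_itv.
pose f (r : R) (y : M) := clamp T r * (m y * U r (c r * y)).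
have iV V r : tame_family V -> mu.-integrable (`]0, +oo[%classic : set M)
    (EFin \o (fun y : M => m y * V r (c r * y))).
  by move=> tV; apply: integrable_tame => //;
    [exact: integrable_mass|exact: mass_ge0].
have intf r : mu.-integrable (`]0, +oo[%classic : set M) (EFin \o f r).
  by have := integrableZl mpos (clamp T r) (iV U r (test_tame hU)).
have FE : (fun r => clamp T r * evol_value U r) =
    (fun r => \int[mu]_(y in `]0, +oo[) f r y).
  by apply/funext => r; rewrite /evol_value -RintegralZl//;
    exact: iV (test_tame hU).
have df r (y : M) : 0 < r < T -> 0 < y -> is_derive r 1 (f ^~ y)
    (m y * (r * DU r (c r * y) + HV r (c r * y))).
  move=> rT y0; have /andP[r0 rT'] := rT.
  have dcl : is_derive r 1 (clamp T) 1.
    apply: (@near_eq_is_derive _ _ _ id _ _ _ _ _ (is_derive_id (r : R^o) 1)).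
    near=> x; rewrite clamp_id// !ltW//; near: x;
      [exact: lt_nbhsl|exact: lt_nbhsr].
  have dU := is_derive_evaluation rT y0.
  apply: (@is_derive_eq _ _ _ (f ^~ y) r 1 _ _
    (is_deriveM dcl (is_deriveM (is_derive_cst (m y) r 1) dU))).
  rewrite /GRing.scale/= clamp_id ?(ltW r0) ?(ltW rT')//.
  have cr : c r = r `^ rho by rewrite scale_factorE// (ltW r0) ltW.
  have cy0 : 0 < c r * y by rewrite cr mulr_gt0// powR_gt0.
  (* Here r times the derivative rho r^(rho - 1) of the scale factor is rho times the scale factor
     itself. *)
  have -> : HV r (c r * y) = U r (c r * y) +
      r * (UX r (c r * y) * (rho * r `^ (rho - 1) * y)).
    rewrite /HV (gtr0_norm cy0); congr (_ + _).
    rewrite {1}cr -[in LHS](@mulr_powRB1 _ r rho) ?(ltW r0) ?rho_gt0//.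
    by ring.
  (* Exposes the value of a pointwise product of functions, so that [ring] sees its factors. *)
  rewrite -[(cst _ * _) r]/(y * phi y * U r (c r * y)).
  by ring.
have [BD HBD] : exists B, forall r x, `|DU r x| <= B by case: (test_dt_tame hU).
have [BH HBH] : exists B, forall r x, `|HV r x| <= B by case: tame_HV.
have BD0 : 0 <= BD by exact: le_trans (HBD 0 0).
have BH0 : 0 <= BH by exact: le_trans (HBH 0 0).
have sI : (`]0, T[%classic : set R) s by rewrite /= in_itv.
have derf1 r (y : M) : (`]0, T[%classic : set R) r ->
    (`]0, +oo[%classic : set M) y -> derivable (f ^~ y) r 1.
  by rewrite /= !in_itv/= andbT => rT y0; have [] := df r y rT y0.
have d1E r (y : M) : (`]0, T[%classic : set R) r ->
    (`]0, +oo[%classic : set M) y ->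
    derive1 (f ^~ y) r = m y * (r * DU r (c r * y) + HV r (c r * y)).
  rewrite /= !in_itv/= andbT => rT y0; have [_ <-] := df r y rT y0.
  by rewrite derive1E.
(* Bounds r DU + HV for 0 < r < T. *)
pose B := T * BD + BH.
have B0 : 0 <= B by rewrite addr_ge0// mulr_ge0// ltW.
have intG : mu.-integrable (`]0, +oo[%classic : set M) (EFin \o (fun y : M =>
  `|B * m y|)).
  have : mu.-integrable (`]0, +oo[%classic : set M) (EFin \o (fun y : M => B *
    m y)).
    by have := integrableZl mpos B integrable_mass.
  exact: integrable_norm.
have Gub r (y : M) : (`]0, T[%classic : set R) r ->
    (`]0, +oo[%classic : set M) y -> `|derive1 (f ^~ y) r| <= `|B * m y|.
  move=> rT yI; rewrite d1E//; move: rT yI; rewrite /= !in_itv/= andbT.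
  move=> /andP[r0 rT'] y0.
  rewrite !normrM (ger0_norm B0) mulrC ler_wpM2r ?mulr_ge0//.
  rewrite (le_trans (ler_normD _ _))// lerD// normrM.
  by rewrite ler_pM// gtr0_norm// ltW.
have D1 := @derivable_under_integral R _ M mu f _ mpos s 0 T sI
  (fun r _ => intf r) derf1 _ (fun y => normr_ge0 _) intG Gub.
have D2 := @differentiation_under_integral R _ M mu f _ mpos s 0 T sI
  (fun r _ => intf r) derf1 _ (fun y => normr_ge0 _) intG Gub.
rewrite FE; apply: DeriveDef; first exact: D1.
rewrite -derive1E D2 /evol_value.
rewrite -RintegralZl//; last exact: iV (test_dt_tame hU).
rewrite -RintegralD//; last 2 first.
- by have := integrableZl mpos s (iV DU s (test_dt_tame hU)).
- exact: iV tame_HV.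
apply: eq_Rintegral => y /[!inE] y0; rewrite /partial1of2 d1E//.
by rewrite mulrDr mulrCA.
Unshelve. all: end_near. Qed.

Lemma continuous_evolution_derivative :
  continuous (fun s => clamp T s * evol_value DU s + evol_value HV s).
Proof.
move=> s; apply: cvgD; last exact: continuous_evol tame_HV _.
apply: cvgM; last exact: continuous_evol (test_dt_tame hU) _.
by apply: continuous_clamp; exact: ltW.
Qed.

Lemma evolution_FTC (t : R) : 0 < t < T ->
  \int[mu]_(s in `[0, t]) (clamp T s * evol_value DU s + evol_value HV s) =
  t * evol_value U t.
Proof.
move=> /andP[t0 tT].
pose G r := clamp T r * evol_value U r.
have cG : continuous G.
  move=> s; apply: cvgM; last exact: continuous_evol (test_tame hU) _.
  by apply: continuous_clamp; exact: ltW.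
have sT s : s \in `]0, t[ -> 0 < s < T.
  by rewrite in_itv/= => /andP[-> st]; exact: lt_trans tT.
rewrite /Rintegral (@continuous_FTC2 R _ G 0 t t0).
(* The boundary term at 0 vanishes because of the factor [clamp T 0], that is 0. *)
- rewrite /G clamp_id ?(ltW t0) ?(ltW tT)// clamp_id ?lexx ?(ltW T0)//.
  by rewrite mul0r /= oppr0 addr0.
- by apply: continuous_subspaceT; exact: continuous_evolution_derivative.
- split.
  + by move=> s /sT /is_derive_evolution[].
  + by apply: cvg_at_right_filter; exact: cG.
  + by apply: cvg_at_left_filter; exact: cG.
- move=> s /sT sT'; rewrite derive1E; have [_ ->] := is_derive_evolution sT'.
  by rewrite clamp_id//; case/andP: sT' => /ltW -> /ltW ->.
Qed.

End evolution.

(** * The weak formulation *)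

Section flow_weak_identity.
Context (R : realType) (gamma : R) (K : R -> R -> R) (phi : R -> R).
Local Notation mu := (@lebesgue_measure R).
Local Notation M := (measurableTypeR R).
Hypothesis hgamma : gamma < 1.
Hypothesis Kcont : {within `]0, +oo[ `*` `]0, +oo[,
                continuous (fun p : R * R => K p.1 p.2)}.
Hypothesis Kge0 : forall x y : R, 0 < x -> 0 < y -> 0 <= K x y.
Hypothesis Ksym : forall x y : R, 0 < x -> 0 < y -> K x y = K y x.
Hypothesis Khom : homogeneous_kernel gamma K.
Hypothesis hphi : self_similar_profile gamma K phi.
Local Notation rho := (2 / (1 - gamma)).
Local Notation F := (self_similar_flow hphi).

Lemma flow_test_integral (s : R) (V : R -> R) : 0 < s ->
  measurable_fun [set: M] V ->
  \int[F s]_(x in `]0, +oo[) (x * V x) =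
  s * \int[mu]_(y in `]0, +oo[) (y * phi y * V (s `^ rho * y)).
Proof.
move=> s0 mV.
have mVs : measurable_fun (`]0, +oo[%classic : set M) (fun y => V (s `^ rho *
  y)).
  by apply: measurable_funTS; apply: (measurableT_comp mV);
    exact: measurable_funM.
rewrite (flow_Rintegral hgamma)//; last first.
  by apply: measurable_funTS; exact: measurable_funM.
transitivity (s `^ (1 - rho) * \int[mu]_(y in `]0, +oo[)
    (s `^ rho * (y * phi y * V (s `^ rho * y)))).
  by congr (_ * _); apply: eq_Rintegral => y _; ring.
rewrite measurable_RintegralZl ?powR_ge0//; last first.
  by apply: measurable_funM => //; exact: measurable_mass hphi.
rewrite mulrA -powRD ?(gt_eqF s0) ?implybT//.
by rewrite subrK powRr1// ltW.
Qed.

(** Only the inner variable is dilated: [flow_collision_integral] rescales the inner integral first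
    and then needs its measurability in [y] to rescale the outer one. *)
Lemma measurable_collision_integral (c : R) (V : R -> R) : 0 < c ->
  measurable_fun [set: M] V ->
  measurable_fun (`]0, +oo[%classic : set M) (fun y =>
    \int[mu]_(x in `]0, +oo[) (phi x * (K y (c * x) *
      ((c * x + y) * V (c * x + y) - c * x * V (c * x) - y * V y)))).
Proof.
move=> c0 mV.
pose psi (y x : R) : R := K y x * ((x + y) * V (x + y) - x * V x - y * V y).
pose g (w : M * M) := (phi \_ (`]0, +oo[%classic : set M)) w.2 *
  (if (0 < w.1) && (0 < c * w.2) then psi w.1 (c * w.2) else 0).
have mg : measurable_fun setT g.
  apply: measurable_funM.
    exact: (measurableT_comp (measurable_profile_patch hphi) measurable_snd).
  have mc : measurable_fun [set: M * M] (fun w : M * M => c * w.2 : M).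
    by apply: measurable_funM => //; exact: measurable_snd.
  have m1 : measurable_fun [set: M * M] (fun w : M * M => w.1).
    exact: measurable_fst.
  exact: (measurableT_comp (measurable_collision Kcont Khom mV)
    (measurable_fun_pair m1 mc)).
have mEg : measurable_fun [set: M * M] (EFin \o g) by exact/measurable_EFinP.
have := measurableT_comp (@fine_measurable R setT measurableT)
  (@measurable_integral_section _ _ M M R mu (EFin \o g) mEg).
move=> /(@measurable_funTS _ _ _ _ (`]0, +oo[%classic : set M)).
apply: eq_measurable_fun => y /[!inE]/= /[!in_itv]/= /[!andbT] y0.
rewrite Rintegral_mkcond; congr fine; apply: eq_integral => x _.
rewrite /g/= !patchE; case: ifPn => [/[!inE]/= /[!in_itv]/= /[!andbT] x0|_].
  by rewrite y0 mulr_gt0.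
by rewrite mul0r.
Qed.

(** Each integral contributes s^(1 - rho), homogeneity of [K] contributes s^(gamma rho), and the
    factors x, y and x + y contribute s^rho. The total exponent 2 - rho (1 - gamma) is 0. *)
Lemma flow_collision_integral (s : R) (V : R -> R) : 0 < s ->
  measurable_fun [set: M] V ->
  \int[F s]_(y in `]0, +oo[) (\int[F s]_(x in `]0, +oo[)
     (K y x * ((x + y) * V (x + y) - x * V x - y * V y))) =
  \int[mu]_(y in `]0, +oo[) (phi y * \int[mu]_(x in `]0, +oo[) (phi x *
     (K y x * ((x + y) * V (s `^ rho * (x + y)) - x * V (s `^ rho * x)
        - y * V (s `^ rho * y))))).
Proof.
move=> s0 mV; set c := s `^ rho; have c0 : 0 < c by rewrite powR_gt0.
set a := s `^ (1 - rho); have a0 : 0 <= a by rewrite powR_ge0.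
pose psi V' (y x : R) : R := K y x * ((x + y) * V' (x + y) - x * V' x - y * V'
  y).
pose Vc x := V (c * x).
have mVc : measurable_fun [set: M] Vc.
  by apply: (measurableT_comp mV); exact: measurable_funM.
pose Q (y : M) := a * \int[mu]_(x in `]0, +oo[) (phi x * psi V y (c * x)).
have mphi := measurable_profile hphi.
have mpsi V' y : measurable_fun [set: M] V' -> 0 < y ->
    measurable_fun (`]0, +oo[%classic : set M) (fun x => phi x * psi V' y x).
  move=> mV' y0; apply: measurable_funM => //.
  exact: (measurable_collision_section Kcont Khom mV' y0).
transitivity (\int[F s]_(y in `]0, +oo[) Q y).
  apply: eq_Rintegral => y /[!inE]/= /[!in_itv]/= /[!andbT] y0.
  rewrite (flow_Rintegral hgamma)//.
  exact: (measurable_collision_section Kcont Khom mV y0).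
have mQ : measurable_fun (`]0, +oo[%classic : set M) Q.
  apply: measurable_funM => //.
  exact: measurable_collision_integral.
rewrite (flow_Rintegral hgamma)// -/c -/a.
transitivity (a * \int[mu]_(y in `]0, +oo[) ((a * (c `^ gamma * c)) * (phi y *
    \int[mu]_(x in `]0, +oo[) (phi x * psi Vc y x)))).
  apply: (congr1 (fun z => a * z)).
  apply: eq_Rintegral => y.
  rewrite inE/= in_itv/= andbT => y0.
  rewrite /Q mulrCA.
  rewrite -[RHS]mulrA.
  apply: (congr1 (fun z => a * z)).
  rewrite [RHS]mulrCA.
  congr (phi y * _).
  have k0 : 0 <= c `^ gamma * c by rewrite mulr_ge0 ?powR_ge0// ltW.
  rewrite -measurable_RintegralZl//; last exact: mpsi.
  apply: eq_Rintegral => x /[!inE]/= /[!in_itv]/= /[!andbT] x0.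
  rewrite /psi Khom// /Vc -mulrDr; ring.
have mI : measurable_fun (`]0, +oo[%classic : set M)
    (fun y => phi y * \int[mu]_(x in `]0, +oo[) (phi x * psi Vc y x)).
  apply: measurable_funM => //.
  have := measurable_collision_integral ltr01 mVc.
  apply: eq_measurable_fun => y _; apply: eq_Rintegral => x _.
  by rewrite /psi !mul1r.
rewrite measurable_RintegralZl ?mulr_ge0 ?powR_ge0 ?(ltW c0)//.
rewrite mulrA [X in X * _](_ : _ = 1) ?mul1r//.
have sD r r' : s `^ r * s `^ r' = s `^ (r + r').
  by rewrite powRD ?(gt_eqF s0) ?implybT.
have g1 : 1 - gamma != 0 by rewrite gt_eqF// subr_gt0.
rewrite /a /c -powRrM !sD (_ : _ + _ = 0) ?powRr0//.
by field.
Qed.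

Section regular.
Variables (T N : R) (U UX DU : R -> R -> R).
Hypothesis T0 : 0 < T.
Hypothesis N0 : 0 < N.
Hypothesis hU : regular_test T N U UX DU.

(** [stationary_weak_identity] for f(y) = U(s, s^rho y), whose term rho y f'(y) is rho x UX(s, x) at
    x = s^rho y. *)
Lemma flow_weak_rate (s : R) : 0 < s <= T ->
  evol_value gamma phi T (fun s x => U s x + rho * (`|x| * UX s x)) s =
  U s 0 + 2^-1 * \int[F s]_(y in `]0, +oo[) (\int[F s]_(x in `]0, +oo[)
    (K y x * ((x + y) * U s (x + y) - x * U s x - y * U s y))).
Proof.
move=> /andP[s0 sT]; have [_ cU _] := test_tame hU;
  have [[B HB] cUX _] := test_dx_tame hU.
rewrite (flow_collision_integral s0 (continuous_measurable_fun (cU s))).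
pose c := s `^ rho; have c0 : 0 < c by rewrite powR_gt0.
have cc : continuous (fun x : R => c * x).
  by move=> x; apply: cvgM; [exact: cvg_cst|exact: cvg_id].
have cf : continuous (fun x => U s (c * x)).
  by move=> x; exact: (@continuous_comp _ _ _ (fun x => c * x) (U s) x (cc x)
    (cU s _)).
have cf' : continuous (fun x => c * UX s (c * x)).
  move=> x; apply: cvgM; first exact: cvg_cst.
  exact: (@continuous_comp _ _ _ (fun x => c * x) (UX s) x (cc x) (cUX s _)).
have df (x : R) : 0 < x -> is_derive x 1 (fun x => U s (c * x)) (c * UX s (c *
  x)).
  move=> x0; have d1 : is_derive x 1 (fun x => c * x) c.
    apply: (@is_derive_eq _ _ _ (fun x => c * x) x 1 _ _
      (is_deriveM (is_derive_cst c x 1) (is_derive_id (x : R^o) 1))).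
    by rewrite scaler0 addr0 /GRing.scale/= mulr1.
  have d2 := test_dx hU s (mulr_gt0 c0 x0).
  by rewrite mulrC; exact: (@is_derive1_comp _ (U s) (fun x => c * x) x _ _ d2
    d1).
(* The support bound [N] in x = c y becomes N / c in y. *)
have supp (x : R) : 0 < x -> N / c < x -> c * UX s (c * x) = 0.
  move=> x0; rewrite ltr_pdivrMr// mulrC => Nx.
  by rewrite (test_dx_supp hU) ?mulr0// gtr0_norm// mulr_gt0.
have bnd (x : R) : 0 < x -> `|c * UX s (c * x)| <= c * B.
  by move=> _; rewrite normrM gtr0_norm// ler_wpM2l// ltW.
have := stationary_weak_identity hgamma Kcont Kge0 Ksym Khom hphi cf cf' df
  supp bnd
  (divr_gt0 N0 c0).
rewrite mulr0 => <-.
apply: eq_Rintegral => y /[!inE]/= /[!in_itv]/= /[!andbT] y0.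
rewrite scale_factorE ?(ltW s0)// -/c (gtr0_norm (mulr_gt0 c0 y0)).
apply: (congr1 (fun z => _ * z)); apply: (congr1 (fun z => _ + z)).
by rewrite -!mulrA (mulrCA y).
Qed.

Lemma flow_weak_formulation (t : R) : 0 < t < T ->
  \int[F t]_(x in `]0, +oo[) (x * U t x) =
    \int[mu]_(s in `[0, t]) (\int[F s]_(x in `]0, +oo[) (x * DU s x))
  + \int[mu]_(s in `[0, t]) (U s 0)
  + 2^-1 * \int[mu]_(s in `[0, t])
      (\int[F s]_(y in `]0, +oo[) (\int[F s]_(x in `]0, +oo[)
         (K y x * ((x + y) * U s (x + y) - x * U s x - y * U s y)))).
Proof.
move=> tT; have /andP[t0 tT'] := tT.
pose HV s x := U s x + rho * (`|x| * UX s x).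
have tHV : tame_family HV by exact: tame_HV hU.
have testE V s : tame_family V -> 0 < s <= T ->
    \int[F s]_(x in `]0, +oo[) (x * V s x) = clamp T s * evol_value gamma phi T
      V s.
  move=> [_ cV _] /andP[s0 sT].
  have sT' : 0 <= s <= T by rewrite ltW.
  rewrite (flow_test_integral s0 (continuous_measurable_fun (cV s))).
  by rewrite /evol_value (clamp_id sT') (scale_factorE _ sT').
have cont_int g : continuous g -> mu.-integrable (`[0, t]%classic : set M)
  (EFin \o g).
  move=> cg; apply: continuous_compact_integrable; first exact: segment_compact.
  exact: continuous_subspaceT.
pose A s := clamp T s * evol_value gamma phi T DU s.
have cA : continuous A.
  move=> s; apply: cvgM; first by apply: continuous_clamp; exact: ltW.
  exact: (continuous_evol hgamma hphi T0 (test_dt_tame hU)).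
have cH : continuous (evol_value gamma phi T HV).
  exact: (continuous_evol hgamma hphi T0 tHV).
have cU0 : continuous (U ^~ 0).
  by apply: (tame_eval (c := cst 0) (test_tame hU)) => s; exact: cvg_cst.
have sT s : s \in `[0, t] -> s = 0 \/ 0 < s <= T.
  rewrite in_itv/= => /andP[]; rewrite le_eqVlt => /predU1P[<-|s0 st];
    first by left.
  by right; rewrite s0 (le_trans st)// ltW.
rewrite (testE U t (test_tame hU)); last by rewrite t0 ltW.
rewrite clamp_id ?(ltW t0) ?(ltW tT')// -(evolution_FTC hgamma hphi T0 hU tT).
have -> : \int[mu]_(s in `[0, t]) (\int[F s]_(x in `]0, +oo[) (x * DU s x)) =
    \int[mu]_(s in `[0, t]) A s.
  apply: eq_Rintegral => s /[!inE] /sT[->|s0].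
    by rewrite flow0_Rintegral// /A clamp_id ?mul0r// lexx ltW.
  exact: testE (test_dt_tame hU) s0.
have -> : \int[mu]_(s in `[0, t])
      (\int[F s]_(y in `]0, +oo[) (\int[F s]_(x in `]0, +oo[)
         (K y x * ((x + y) * U s (x + y) - x * U s x - y * U s y)))) =
    \int[mu]_(s in `[0, t]) (2 * (evol_value gamma phi T HV s - U s 0)).
  apply: eq_Rintegral => s /[!inE] /sT[->|s0].
    (* At time 0 the collision term is 0 because the measure is. The scale factor is 0 too, so the
       rate is U(0, 0) times the unit mass and the identity persists. *)
    rewrite flow0_Rintegral// /evol_value.
    have c00 : scale_factor gamma T 0 = 0.
      by rewrite scale_factorE ?lexx ?(ltW T0)// powR0// gt_eqF// rho_gt0.
    transitivity (2 * (U 0 0 * \int[mu]_(y in `]0, +oo[) (y * phi y) - U 0 0)).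
      by rewrite /Rintegral (profile_mass hphi)/= mulr1 subrr mulr0.
    rewrite -RintegralZl//; last exact: integrable_mass hphi.
    congr (2 * (_ - _)); apply: eq_Rintegral => y _.
    by rewrite c00 mul0r /HV normr0 mul0r mulr0 addr0 mulrC.
  rewrite (flow_weak_rate s0) addrAC subrr add0r mulrA mulfV ?pnatr_eq0//.
  by rewrite mul1r.
have iHU : mu.-integrable (`[0, t]%classic : set M)
    (EFin \o (fun s => evol_value gamma phi T HV s - U s 0)).
  by apply: cont_int => s; apply: cvgB; [exact: cH|exact: cU0].
rewrite RintegralZl// mulrA mulVf// mul1r.
rewrite RintegralB//; [|exact: cont_int|exact: cont_int].
rewrite RintegralD//; [|exact: cont_int|exact: cont_int].
by rewrite addrACA subrr addr0 -/A.
Qed.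

End regular.

End flow_weak_identity.

(** * Moments and time continuity of the flow *)

Section flow_regularity.
Context (R : realType) (gamma lambda c1 : R) (K : R -> R -> R) (phi : R -> R)
  (T : R).
Local Notation mu := (@lebesgue_measure R).
Local Notation M := (measurableTypeR R).
Hypothesis hgamma : gamma < 1.
Hypothesis hc1 : 0 < c1.
Hypothesis Kcont : {within `]0, +oo[ `*` `]0, +oo[,
                continuous (fun p : R * R => K p.1 p.2)}.
Hypothesis Kge0 : forall x y : R, 0 < x -> 0 < y -> 0 <= K x y.
Hypothesis Khom : homogeneous_kernel gamma K.
Hypothesis Klower : forall x y : R, 0 < x -> 0 < y ->
  c1 * weight_kernel gamma lambda x y <= K x y.
Hypothesis hphi : self_similar_profile gamma K phi.
Hypothesis T0 : 0 < T.
Local Notation rho := (2 / (1 - gamma)).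
Local Notation F := (self_similar_flow hphi).

Section moment.
Variable a : R.
Hypothesis ga : (gamma + 1) / 2 < a.
Hypothesis a1 : a <= 1.

(** The power of t in the moment of order [a] of F(t); it is positive precisely when a > (gamma + 1)
    / 2. *)
Let kappa := 1 + (a - 1) * rho.

Let kappa_gt0 : 0 < kappa.
Proof.
have g0 : 0 < 1 - gamma by rewrite subr_gt0.
have -> : kappa = ((1 - gamma) + (a - 1) * 2) / (1 - gamma).
  by rewrite /kappa; field; rewrite gt_eqF.
have ga' : gamma + 1 < a * 2 by rewrite -ltr_pdivrMr.
apply: divr_gt0 => //; move: ga'; rewrite -subr_gt0.
by congr (0 < _); ring.
Qed.

Let moment_int := integrable_moment hgamma hc1 Kcont Kge0 Khom Klower hphi ga
  a1.

Lemma flow_moment_bound : exists C : R, forall t, 0 <= t <= T ->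
  (\int[F t]_(x in `]0%R, +oo[) (x `^ a)%:E <= C%:E)%E.
Proof.
have I0 : (0 <= \int[mu]_(y in `]0%R, +oo[) (y `^ a * phi y)%:E)%E.
  apply: integral_ge0 => y; rewrite /= in_itv/= andbT => y0.
  by rewrite lee_fin mulr_ge0 ?powR_ge0// (profile_ge0 hphi).
have Ifin := integrable_fin_num (measurable_itv _ : measurable (`]0,
  +oo[%classic : set M)) moment_int.
exists (T `^ kappa * fine (\int[mu]_(y in `]0%R, +oo[) (y `^ a * phi y)%:E)%E)
  => t.
rewrite le_eqVlt => /andP[/predU1P[<-|t0] tT].
  by rewrite flow0_integral// lee_fin mulr_ge0 ?powR_ge0 ?fine_ge0.
rewrite flow_moment// EFinM fineK// -/kappa lee_wpmul2r// lee_fin.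
by apply: ge0_ler_powR; rewrite ?nnegrE// ltW.
Qed.

(** After rescaling, the tested moment is t^kappa times a function continuous on [0, T]; as kappa >
    0 it tends to 0 at the origin of time, matching F(0) = 0. *)
Lemma flow_radon_continuous : radon_continuous T a F.
Proof.
split=> [t _|t tT B|psi B cpsi psi_supp].
- exact: flow_nonpos.
- have [C HC] := flow_moment_bound.
  apply: (@le_lt_trans _ _ C%:E); last by rewrite ltry.
  apply: le_trans (HC t tT); apply: ge0_subset_integral => //.
  + by apply/measurable_EFinP/measurable_funTS; exact: measurable_powR.
  + by move=> x _; rewrite lee_fin powR_ge0.
  + by move=> x /=; rewrite !in_itv/= andbT => /andP[].
pose N := Num.max B 1; have N0 : 0 < N by rewrite lt_max ltr01 orbT.
have psiN x : N < x -> psi x = 0.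
  by rewrite gt_max => /andP[Bx _]; exact: psi_supp.
have cpsi' := within_continuous_norm cpsi.
have [C HC] := supported_bounded N0 cpsi psiN.
(* The reflected test function as a family constant in time. *)
pose V (s x : R) := psi `|x|.
have tV : tame_family V.
  split.
  - by exists C => s x; exact: HC.
  - by move=> s; exact: cpsi'.
  - by move=> s e e0; near=> r => x; rewrite /V subrr normr0 ltW.
pose G t := `|clamp T t| `^ kappa * \int[mu]_(y in `]0, +oo[)
  ((y `^ a * phi y) * V t (scale_factor gamma T t * y)).
have cG : continuous G.
  move=> t; apply: cvgM.
    apply: (@continuous_comp _ _ _ (clamp T) (fun x : R => `|x| `^ kappa)).
      by apply: continuous_clamp; exact: ltW.
    exact: continuous_norm_powR kappa_gt0 _.
  apply: continuous_tame_integral => //.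
  - exact: continuous_scale_factor.
  - by move=> y y0; rewrite mulr_ge0 ?powR_ge0 ?(profile_ge0 hphi).
have cGT : {within `[0, T], continuous G} by exact: continuous_subspaceT.
apply: subspace_eq_continuous cGT => t /[!inE] tT; rewrite /from_subspace.
have : 0 <= t <= T by move: tT; rewrite /= in_itv.
move=> {}tT; have /andP[t0' tT'] := tT.
have : (0 == t) || (0 < t) by rewrite -le_eqVlt.
move=> /predU1P[<-|t0].
  rewrite flow0_Rintegral// /G clamp_id ?lexx ?(ltW T0)// normr0.
  by rewrite powR0 ?mul0r// gt_eqF.
rewrite (flow_Rintegral hgamma)//; last first.
  apply: measurable_funM; first by apply: measurable_funTS;
    exact: measurable_powR.
  by apply: subspace_continuous_measurable_fun => //;
    apply: continuous_subspaceW cpsi;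
    move=> x /=; rewrite !in_itv/= !andbT => /ltW.
rewrite /G clamp_id// (gtr0_norm t0) scale_factorE//.
have mVt : measurable_fun (`]0, +oo[%classic : set M)
    (fun y => y `^ a * phi y * V t (t `^ rho * y)).
  apply: measurable_funM; first exact: measurable_moment hphi _.
  apply: measurable_funTS; apply: (measurableT_comp (f := V t)).
    exact: continuous_measurable_fun.
  exact: measurable_funM.
rewrite (_ : kappa = (1 - rho) + rho * a); last by rewrite /kappa; ring.
rewrite powRD ?(gt_eqF t0) ?implybT// powRrM -mulrA; congr (_ * _).
rewrite -measurable_RintegralZl ?powR_ge0//.
apply: eq_Rintegral => y /[!inE]/= /[!in_itv]/= /[!andbT] y0.
rewrite /V (gtr0_norm (mulr_gt0 _ y0)) ?powR_gt0//.
by rewrite powRM ?powR_ge0 ?(ltW y0)//; ring.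
Unshelve. all: end_near. Qed.

End moment.

(** On [1, +oo[ the power x^p is at most x, and the mass of F(t) is t <= T. *)
Lemma flow_moment_infty (p t : R) : p <= 1 -> 0 <= t <= T ->
  (\int[F t]_(x in `[1%R, +oo[) (x `^ p)%:E <= T%:E)%E.
Proof.
move=> p1; rewrite le_eqVlt => /andP[/predU1P[<-|t0] tT].
  by rewrite flow0_integral// lee_fin ltW.
apply: (@le_trans _ _ t%:E); last by rewrite lee_fin.
rewrite -(flow_mass hgamma hphi t0).
apply: (@le_trans _ _ (\int[F t]_(x in `[1%R, +oo[) x%:E)%E).
  apply: ge0_integral_mono => x; rewrite /= in_itv/= andbT => x1;
    rewrite lee_fin.
    exact: powR_ge0.
  by rewrite ler1_powR.
apply: ge0_subset_integral => //.
- by move=> x; rewrite /= in_itv/= andbT => /ltW x0; rewrite lee_fin.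
- by move=> x /=; rewrite !in_itv/= !andbT; apply: lt_le_trans.
Qed.

End flow_regularity.

(** * Admissible exponents and return to the original test functions *)

Theorem theorem3p6 (R : realType) (gamma lambda c1 c2 : R)
    (K : R -> R -> R) (phi : R -> R) (T : R)
    (hgamma : gamma < 1) (hlambda : `|gamma + 2 * lambda| < 1)
    (hc1 : 0 < c1) (hc12 : c1 <= c2)
    (Kcont : {within `]0, +oo[ `*` `]0, +oo[,
                continuous (fun p : R * R => K p.1 p.2)})
    (Kge0 : forall x y : R, 0 < x -> 0 < y -> 0 <= K x y)
    (Ksym : forall x y : R, 0 < x -> 0 < y -> K x y = K y x)
    (Khom : homogeneous_kernel gamma K)
    (Kbounds : forall x y : R, 0 < x -> 0 < y ->
       c1 * weight_kernel gamma lambda x y <= K x y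
         <= c2 * weight_kernel gamma lambda x y)
    (hphi : self_similar_profile gamma K phi) (hT : 0 < T) :
  constant_flux_solution gamma lambda K T (exponent_origin gamma lambda)
    (self_similar_flow hphi)
  /\ (gamma < -1 ->
      constant_flux_solution gamma lambda K T 0 (self_similar_flow hphi)).
Proof.
have Klower (x y : R) : 0 < x -> 0 < y ->
    c1 * weight_kernel gamma lambda x y <= K x y.
  by move=> x0 y0; have /andP[] := Kbounds x y x0 y0.
have [lam1 lam2] : - 1 < gamma + 2 * lambda /\ gamma + 2 * lambda < 1.
  by apply/andP; rewrite -ltr_norml.
pose q := exponent_origin gamma lambda.
(* The three entries of the minimum exceed (gamma + 1) / 2 because gamma + 2 lambda > -1, gamma + 2
   lambda < 1 and gamma < 1 respectively. *)
have qg : (gamma + 1) / 2 < q.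
  by rewrite /q /exponent_origin !lt_min; apply/andP; split; [apply/andP;
    split|]; lra.
have q1 : q <= 1 by rewrite /q /exponent_origin ge_min lexx orbT.
have p1 : exponent_infty gamma lambda <= 1.
  by rewrite /exponent_infty ge_max; apply/andP; split; lra.
(* Both claims are instances, with [a] the exponent at the origin and with a = 0; the latter is
   admissible since gamma < -1 makes (gamma + 1) / 2 negative. *)
suff sol a : (gamma + 1) / 2 < a -> a <= 1 ->
    constant_flux_solution gamma lambda K T a (self_similar_flow hphi).
  by split=> [|g1]; apply: sol => //; lra.
move=> ga a1; split.
- exact: (flow_radon_continuous hgamma hc1 Kcont Kge0 Khom Klower hphi hT ga
  a1).
- by move=> A _; exact: flow0.
- have [C HC] := flow_moment_bound hgamma hc1 Kcont Kge0 Khom Klower hphi hT qg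
  q1.
  apply: (@le_lt_trans _ _ C%:E); last by rewrite ltry.
  apply: ge_ereal_sup => _ [s /= sT <-]; rewrite in_itv/= in sT.
  apply: le_trans (HC s sT); apply: ge0_subset_integral => //.
  + by apply/measurable_EFinP; apply: measurable_funTS; exact: measurable_powR.
  + by move=> x _; rewrite lee_fin powR_ge0.
  + by move=> x /=; rewrite !in_itv/= andbT => /andP[].
- apply: (@le_lt_trans _ _ T%:E); last by rewrite ltry.
  apply: ge_ereal_sup => _ [s /= sT <-]; rewrite in_itv/= in sT.
  exact: flow_moment_infty.
move=> u du Hu t /andP[]; rewrite le_eqVlt => /predU1P[<- _|t0 tT].
  (* At t = 0 the measure is 0 and the time integrals run over a single point. *)
  by rewrite flow0_Rintegral// set_itv1 !Rintegral_set1 mulr0 !addr0.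
have [N [UX [N0 hU]]] := C1_time_C1c_regular hT Hu.
have tT' : 0 < t < T by rewrite t0.
(* The extended functions agree with the original ones on [0, T] x [0, +oo[, where all the integrals
   of the weak formulation live. *)
have extE v s x : 0 <= s <= T -> 0 <= x -> extend T v s x = v s x.
  by move=> sT x0; rewrite /extend clamp_id// ger0_norm.
have tI : 0 <= t <= T by rewrite !ltW.
have sT s : (`[0, t]%classic : set R) s -> 0 <= s <= T.
  by rewrite /= in_itv/= => /andP[-> st]; rewrite (le_trans st)// ltW.
have := flow_weak_formulation hgamma Kcont Kge0 Ksym Khom hphi hT N0 hU tT'.
have -> : \int[self_similar_flow hphi t]_(x in `]0, +oo[) (x * extend T u t x) =
    \int[self_similar_flow hphi t]_(x in `]0, +oo[) (x * u t x).
  apply: eq_Rintegral => x /[!inE]/= /[!in_itv]/= /[!andbT] x0.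
  by rewrite extE// ltW.
have split3 (x y z x' y' z' : R) : x = x' -> y = y' -> z = z' ->
    x + y + 2^-1 * z = x' + y' + 2^-1 * z' by move=> -> -> ->.
move=> ->; apply: split3; apply: eq_Rintegral => s /[!inE] /sT {}sT.
- apply: eq_Rintegral => x /[!inE]/= /[!in_itv]/= /[!andbT] x0.
  by rewrite extE// ltW.
- by rewrite extE.
- apply: eq_Rintegral => y /[!inE]/= /[!in_itv]/= /[!andbT] y0.
  apply: eq_Rintegral => x /[!inE]/= /[!in_itv]/= /[!andbT] x0.
  by rewrite !extE ?(ltW x0) ?(ltW y0)// ltW// addr_gt0.
Qed.
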